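(* The Banach space $(\mathfrak X,\|\cdot\|)$ is arbitrarily $\omega_1$-distortable; that is, $$\sup_{|||\cdot|||} d_{\omega_1}(\mathfrak X,|||\cdot|||)=\infty,\qquad d_{\omega_1}(\mathfrak X,|||\cdot|||)=\inf_Y\ \sup\Big\{\frac{|||x|||}{|||y|||}: x,y\in Y,\ \|x\|=\|y\|=1\Big\},$$ where the supremum is taken over all equivalent norms $|||\cdot|||$ on $\mathfrak X$ and the infimum is taken over all non-separable subspaces $Y$ of $\mathfrak X$.
   Context: Scalars are real. $c_{00}(\omega_1)$ is the space of finitely supported functions $\omega_1\to\mathbb R$, with canonical Hamel basis $(e_\alpha)_{\alpha<\omega_1}$; an element $\phi\in c_{00}(\omega_1)$ acts as a functional by $\phi(x)=\sum_\alpha \phi(\alpha)x(\alpha)$, and $e_\alpha^*$ is $e_\alpha$ regarded as a functional. For sets of ordinals $s<t$ means that every element of $s$ is smaller than every element of $t$; for vectors $x<y$ means $\mathrm{supp}\,x<\mathrm{supp}\,y$. A block sequence is a $<$-increasing sequence (of finite sets, or of finitely supported vectors). The function $\varrho$. Fix $\varrho:[\omega_1]^2\to\omega$ such that for all $\alpha<\beta<\gamma<\omega_1$: $\varrho(\alpha,\gamma)\le\max\{\varrho(\alpha,\beta),\varrho(\beta,\gamma)\}$ and $\varrho(\alpha,\beta)\le\max\{\varrho(\alpha,\gamma),\varrho(\beta,\gamma)\}$; and $\{\alpha<\beta:\varrho(\alpha,\beta)\le n\}$ is finite for all $\beta<\omega_1$, $n\in\omega$. Put $\varrho(\alpha,\alpha)=0$.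 For $s,t\subseteq\omega_1$, $\varrho(s,t)=\min\{\varrho(\alpha,\beta):\alpha\in s,\beta\in t\}$. A sequence $(s_i)_i$ of sets is $p$-separated if $\varrho(s_i,s_j)\ge p$ for all $i\ne j$, and separated if it is $|\bigcup_i s_i|$-separated. These notions apply to vectors and functionals via their supports. For finite $F\subseteq\omega_1$ let $p_\varrho(F)=\max\{\varrho(\alpha,\beta):\alpha,\beta\in F\}$ and $\overline F^{\,p}=\{\alpha:\exists\beta\in F,\ \alpha\le\beta,\ \varrho(\alpha,\beta)\le p\}$ (a finite set). Parameters: $m_1=2$, $m_{j+1}=m_j^4$; $n_1=4$, $n_{j+1}=(4n_j)^{s_j}$ with $s_j=\log_2 m_{j+1}^3$. Coding. $Q_s(\omega_1)$ is the set of finite sequences $\Phi=(\phi_1,w_1,p_1,\dots,\phi_d,w_d,p_d)$ with $\phi_1<\dots<\phi_d$ nonzero elements of $c_{00}(\omega_1)$ with rational values, $(w_i)$ and $(p_i)$ strictly increasing sequences of positive integers, and $p_i\ge p_\varrho(\bigcup_{k\le i}\mathrm{supp}\,\phi_k)$ for all $i\le d$. $Q_s$ is the (countable) set of finite sequences of the same form with $\phi_i\in c_{00}(\omega)$, satisfying the same requirements except the last one. Fix a one-to-one $\sigma:Q_s\to\{2j: j\text{ odd}\}$ with $\sigma(\phi_1,w_1,p_1,\dots,\phi_d,w_d,p_d)>\max\{p_d^2,1/\varepsilon^2,\max\mathrm{supp}\,\phi_d\}$, where $\varepsilon=\min\{|\phi_k(\alpha)|:\alpha\in\mathrm{supp}\,\phi_k,\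 k\le d\}$. For $\Phi\in Q_s(\omega_1)$ let $G=\overline{\bigcup_{i\le d}\mathrm{supp}\,\phi_i}^{\,p_d}$, let $\pi_G:\{1,\dots,|G|\}\to G$ be the increasing enumeration, let $\pi_G(\phi_k)(n)=\phi_k(\pi_G(n))$ for $1\le n\le|G|$ and $0$ otherwise, and set $\sigma_\varrho(\Phi)=\sigma(\pi_G(\phi_1),w_1,p_1,\dots,\pi_G(\phi_d),w_d,p_d)$. Norming set. $K$ is the minimal subset of $c_{00}(\omega_1)$ such that: (i) $K$ contains all $e_\gamma^*$, is symmetric, and is closed under restriction to intervals of $\omega_1$; (ii) for every $j\geq 1$ and every separated block sequence $(\phi_i)_{i=1}^d\subseteq K$ with $d\le n_{2j}$, $\frac1{m_{2j}}\sum_{i=1}^d\phi_i\in K$; (iii) for every $j\ge1$ and every separated $(2j+1)$-special sequence $(\phi_i)_{i=1}^d\subseteq K$ with $d\le n_{2j+1}$, $\frac1{m_{2j+1}}\sum_{i=1}^d\phi_i\in K$; (iv) $K$ is closed under rational convex combinations. A functional of the form given in (ii) or (iii) with factor $1/m_j$ is said to have weight $w(\phi)=m_j$ (and to be of type I). A block sequence $(\phi_1,\dots,\phi_d)$ in $K$ is $(2j+1)$-special if each $\phi_k$ has a weight $w(\phi_k)=m_{2j_k}$, with $j_1$ even and $m_{2j_1}>n_{2j+1}^2$, and there are integers $p_1<\dots<p_{d-1}$ such that for all $1\le i<d$, $\Phi_i=(\phi_1,w(\phi_1),p_1,\dots,\phi_i,w(\phi_i),p_i)\in Q_s(\omega_1)$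 and $w(\phi_{i+1})=m_{\sigma_\varrho(\Phi_i)}$. $\mathfrak X$ is the completion of $c_{00}(\omega_1)$ under the norm $\|x\|=\sup\{\phi(x):\phi\in K\}$. *)

(* Defs.v *)
From HB Require Import structures.
From mathcomp Require Import all_boot all_order all_algebra.
From mathcomp Require Import finmap.
From mathcomp Require Import all_classical all_reals all_analysis.
(* The notations of monalg are incompatible with those of mathcomp-analysis. *)
From mathcomp.multinomials Require Import -(notations) monalg.

Set Implicit Arguments.
Unset Strict Implicit.
Unset Printing Implicit Defensive.

Import Order.TTheory GRing.Theory Num.Theory.
Import numFieldNormedType.Exports.

Local Open Scope classical_set_scope.
Local Open Scope ring_scope.

(* These properties determine omega_1 up to a unique order isomorphism. *)
Record is_omega1 (d : Order.disp_t) (W : orderType d) : Prop := IsOmega1 {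
  omega1_wo : wochoice.well_order (<=%O : rel W);
  omega1_uncountable : ~ countable [set: W];
  omega1_initial : forall a : W, countable [set b | (b < a)%O]
}.

(* [malg I R] is the free R-module on I, i.e. the finitely supported functions
   from I to R: [mcoeff a x] is x(a), [msupp x] is the support, and
   [mkmalgU a c] is c times the basis vector at a. *)
Notation c00 I R := (malg I R).

Definition basis_vec (I : choiceType) (R : realType) (a : I) : c00 I R :=
  mkmalgU a 1.

Definition act (I : choiceType) (R : realType) (phi x : c00 I R) : R :=
  \sum_(a <- msupp phi) mcoeff a phi * mcoeff a x.

(* Every order-convex subset of omega_1 is of the form [a, b) or [a, oo),
   so [interval W] accounts for all the intervals. *)
Definition restrict (d : Order.disp_t) (I : orderType d) (R : realType)
    (J : interval I) (phi : c00 I R) : c00 I R :=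
  \sum_(a <- msupp phi | a \in J) mkmalgU a (mcoeff a phi).

Definition supp_lt (d : Order.disp_t) (I : orderType d) (R : realType)
    (phi psi : c00 I R) : bool :=
  allrel <%O (msupp phi) (msupp psi).

(* All pairs are compared, because < is not transitive when some of the
   vectors vanish. *)
Definition block (d : Order.disp_t) (I : orderType d) (R : realType)
    (s : seq (c00 I R)) : bool :=
  pairwise (@supp_lt d I R) s.

Definition supports (I : choiceType) (R : realType) (s : seq (c00 I R)) :
    {fset I} :=
  (\bigcup_(phi <- s) msupp phi)%fset.

(* rho is defined on all pairs: symmetric, and zero on the diagonal. *)
Record rho_function (d : Order.disp_t) (W : orderType d) (rho : W -> W -> nat) :
    Prop := RhoFunction {
  rho_sym : forall a b, rho a b = rho b a;
  rho_diag : forall a, rho a a = 0%N;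
  rho_ultra : forall a b c, (a < b)%O -> (b < c)%O ->
    (rho a c <= maxn (rho a b) (rho b c))%N;
  rho_subadd : forall a b c, (a < b)%O -> (b < c)%O ->
    (rho a b <= maxn (rho a c) (rho b c))%N;
  rho_finite : forall b n, finite_set [set a | (a < b)%O && (rho a b <= n)%N]
}.

(* The minimum over an empty set of pairs counts as +oo. *)
Definition p_separated (I : choiceType) (R : realType) (rho : I -> I -> nat)
    (p : nat) (s : seq (c00 I R)) : Prop :=
  forall i k, (i < size s)%N -> (k < size s)%N -> i <> k ->
    allrel (fun a b => p <= rho a b)%N (msupp s`_i) (msupp s`_k).

Definition separated (I : choiceType) (R : realType) (rho : I -> I -> nat)
    (s : seq (c00 I R)) : Prop :=
  p_separated rho #|` supports s| s.

Definition p_rho (I : choiceType) (rho : I -> I -> nat) (F : {fset I}) : nat :=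
  (\max_(a <- F) \max_(b <- F) rho a b)%N.

(* [fset_set] is meaningful here: under [rho_function] the set is finite. *)
Definition rho_closure (d : Order.disp_t) (W : orderType d)
    (rho : W -> W -> nat) (p : nat) (F : {fset W}) : {fset W} :=
  fset_set [set a | exists2 b, b \in F & (a <= b)%O && (rho a b <= p)%N].

(* Indexed from 1; the value at 0 is junk. *)
Definition m_ (j : nat) : nat := iter j.-1 (fun m => m ^ 4)%N 2%N.

(* [n_succ i] is n_(i+1). As m_ j is a power of 2, [trunc_log 2] is the exact
   logarithm. *)
Fixpoint n_succ (i : nat) : nat :=
  if i is i'.+1 then ((4 * n_succ i') ^ trunc_log 2 (m_ i.+1 ^ 3))%N else 4%N.

Definition n_ (j : nat) : nat := n_succ j.-1.

(* A code (phi_1, w_1, p_1, ..., phi_d, w_d, p_d), as a list of triples. *)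
Notation triples I R := (seq (c00 I R * nat * nat)%type).

Definition code_fns (I : choiceType) (R : realType) (Phi : triples I R) :
    seq (c00 I R) := [seq e.1.1 | e <- Phi].
Definition code_wts (I : choiceType) (R : realType) (Phi : triples I R) :
    seq nat := [seq e.1.2 | e <- Phi].
Definition code_seps (I : choiceType) (R : realType) (Phi : triples I R) :
    seq nat := [seq e.2 | e <- Phi].

Definition strictly_increasing_pos (s : seq nat) : bool :=
  sorted ltn s && all (leq 1) s.

(* With I = nat this is Q_s. Codes are nonempty, since p_d and phi_d are used. *)
Definition in_Qs (d : Order.disp_t) (I : orderType d) (R : realType)
    (Phi : triples I R) : Prop :=
  [/\ Phi != [::],
      block (code_fns Phi),
      forall phi, phi \in code_fns Phi ->
        phi != 0 /\ forall a, rational (mcoeff a phi),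
      strictly_increasing_pos (code_wts Phi) &
      strictly_increasing_pos (code_seps Phi)].

Definition in_Qs_omega1 (d : Order.disp_t) (W : orderType d) (R : realType)
    (rho : W -> W -> nat) (Phi : triples W R) : Prop :=
  in_Qs Phi /\
  forall i, (i < size Phi)%N ->
    (p_rho rho (supports (take i.+1 (code_fns Phi))) <=
       nth 0 (code_seps Phi) i)%N.

(* The infimum is a minimum: the set is finite, and nonempty on Q_s. *)
Definition code_eps (I : choiceType) (R : realType) (Phi : triples I R) : R :=
  inf [set r | exists2 phi, phi \in code_fns Phi &
                 exists2 a, a \in msupp phi & r = `|mcoeff a phi|].

Record coding_function (R : realType) (sigma : triples nat R -> nat) :
    Prop := CodingFunction {
  coding_inj : forall Phi Psi, in_Qs Phi -> in_Qs Psi ->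
    sigma Phi = sigma Psi -> Phi = Psi;
  coding_range : forall Phi, in_Qs Phi ->
    exists2 j, odd j & sigma Phi = (2 * j)%N;
  coding_gt_p : forall Phi, in_Qs Phi ->
    (last 0 (code_seps Phi) ^ 2 < sigma Phi)%N;
  coding_gt_eps : forall Phi, in_Qs Phi ->
    1 / code_eps Phi ^+ 2 < (sigma Phi)%:R;
  coding_gt_supp : forall Phi, in_Qs Phi ->
    (\max_(a <- msupp (last 0%R (code_fns Phi))) a < sigma Phi)%N
}.

(* [(index a s).+1] is the position of a, counted from 1, in the increasing
   enumeration s of G: this is the vector n |-> phi (pi_G n), supported in
   {1, ..., |G|}. *)
Definition collapse (d : Order.disp_t) (W : orderType d) (R : realType)
    (G : {fset W}) (phi : c00 W R) : c00 nat R :=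
  \sum_(a <- G) mkmalgU (index a (sort <=%O G)).+1 (mcoeff a phi).

Definition sigma_rho (d : Order.disp_t) (W : orderType d) (R : realType)
    (rho : W -> W -> nat) (sigma : triples nat R -> nat) (Phi : triples W R) :
    nat :=
  let G := rho_closure rho (last 0%N (code_seps Phi))
             (supports (code_fns Phi)) in
  sigma [seq (collapse G e.1.1, e.1.2, e.2) | e <- Phi].

(* (phi_1, m_(2 j_1), p_1, ..., phi_i, m_(2 j_i), p_i); js and ps are indexed
   from 0. *)
Definition special_code (I : choiceType) (R : realType) (s : seq (c00 I R))
    (js ps : nat -> nat) (i : nat) : triples I R :=
  [seq (s`_k, m_ (2 * js k), ps k) | k <- iota 0 i].

Definition scaled_sum (I : choiceType) (R : realType) (m : nat)
    (s : seq (c00 I R)) : c00 I R :=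
  m%:R^-1 *: \sum_(phi <- s) phi.

(* [norming] is K, [has_weight w phi] means that phi is of type I with weight w
   (a functional may have several weights), and [special j s] means that s is a
   (2j+1)-special sequence. The three notions depend on each other positively,
   so that "the minimal set" is an inductive definition. *)
Inductive norming (d : Order.disp_t) (W : orderType d) (R : realType)
    (rho : W -> W -> nat) (sigma : triples nat R -> nat) : c00 W R -> Prop :=
| norming_basis : forall a : W, norming rho sigma (basis_vec R a)
| norming_opp : forall phi,
    norming rho sigma phi -> norming rho sigma (- phi)
| norming_restrict : forall (J : interval W) phi,
    norming rho sigma phi -> norming rho sigma (restrict J phi)
| norming_weight : forall w phi,
    has_weight rho sigma w phi -> norming rho sigma phi
| norming_conv : forall n (c : 'I_n -> rat) (phi : 'I_n -> c00 W R),
    (forall i, 0 <= c i) -> \sum_(i < n) c i = 1 ->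
    (forall i, norming rho sigma (phi i)) ->
    norming rho sigma (\sum_(i < n) ratr (c i) *: phi i)
with has_weight (d : Order.disp_t) (W : orderType d) (R : realType)
    (rho : W -> W -> nat) (sigma : triples nat R -> nat) :
    nat -> c00 W R -> Prop :=
| weight_even : forall j (s : seq (c00 W R)),
    (1 <= j)%N -> s != [::] ->
    (forall phi, phi \in s -> norming rho sigma phi) ->
    block s -> separated rho s -> (size s <= n_ (2 * j))%N ->
    has_weight rho sigma (m_ (2 * j)) (scaled_sum (m_ (2 * j)) s)
| weight_odd : forall j (s : seq (c00 W R)),
    (1 <= j)%N ->
    special rho sigma j s ->
    separated rho s -> (size s <= n_ (2 * j).+1)%N ->
    has_weight rho sigma (m_ (2 * j).+1) (scaled_sum (m_ (2 * j).+1) s)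
with special (d : Order.disp_t) (W : orderType d) (R : realType)
    (rho : W -> W -> nat) (sigma : triples nat R -> nat) :
    nat -> seq (c00 W R) -> Prop :=
| special_intro : forall j (s : seq (c00 W R)) (js ps : nat -> nat),
    s != [::] ->
    (forall phi, phi \in s -> norming rho sigma phi) ->
    block s ->
    (forall k, (k < size s)%N -> (1 <= js k)%N) ->
    (forall k, (k < size s)%N ->
       has_weight rho sigma (m_ (2 * js k)) s`_k) ->
    ~~ odd (js 0%N) ->
    (n_ (2 * j).+1 ^ 2 < m_ (2 * js 0))%N ->
    (forall i k, (i < k)%N -> (k.+1 < size s)%N -> (ps i < ps k)%N) ->
    (forall i, (0 < i < size s)%N ->
       in_Qs_omega1 rho (special_code s js ps i)) ->
    (forall i, (0 < i < size s)%N ->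
       m_ (2 * js i) = m_ (sigma_rho rho sigma (special_code s js ps i))) ->
    special rho sigma j s.

(* X is the completion of c_00(omega_1) for the norm induced by K, through the
   embedding iota. *)
Record is_completion (d : Order.disp_t) (W : orderType d) (R : realType)
    (rho : W -> W -> nat) (sigma : triples nat R -> nat)
    (X : completeNormedModType R) (iota : {linear c00 W R -> X}) :
    Prop := IsCompletion {
  completion_norm : forall x,
    `|iota x| = sup [set act phi x | phi in norming rho sigma];
  completion_dense : dense (range iota)
}.

Record equivalent_norm (R : realType) (X : normedModType R) (N : X -> R) :
    Prop := EquivalentNorm {
  enorm_triangle : forall x y, N (x + y) <= N x + N y;
  enorm_scale : forall a x, N (a *: x) = `|a| * N x;
  enorm_eq0 : forall x, N x = 0 -> x = 0;
  enorm_equiv : exists c C : R, [/\ 0 < c, 0 < C &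
    forall x, c * `|x| <= N x /\ N x <= C * `|x|]
}.

Definition separable (T : topologicalType) (Y : set T) : Prop :=
  exists D : set T, [/\ countable D, D `<=` Y & Y `<=` closure D].

Definition nonseparable_subspace (R : realType) (X : normedModType R)
    (Y : set X) : Prop :=
  submod_closed [in Y] /\ ~ separable Y.

Definition distortion_omega1 (R : realType) (X : normedModType R)
    (N : X -> R) : \bar R :=
  ereal_inf
    [set ereal_sup [set (N p.1 / N p.2)%:E | p in
           [set p : X * X | [/\ Y p.1, Y p.2, `|p.1| = 1 & `|p.2| = 1]]]
    | Y in [set Y : set X | nonseparable_subspace Y]].

Definition arbitrarily_omega1_distortable (R : realType)
    (X : normedModType R) : Prop :=
  ereal_sup [set distortion_omega1 N | N in
    [set N : X -> R | equivalent_norm N]] = +oo%E.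

(* Main.v *)
(** For J = 2j, renorm X by the supremum over functionals of weight m_J plus a
    small multiple of the original norm. A non-separable subspace Y contains, up
    to small errors, uncountably many block vectors going beyond every countable
    ordinal, because the projections on initial segments are separable. As only
    finitely many points below a given one are rho-close to it, such block
    vectors and functionals norming them can be chosen separated, and averaging
    operations of even weight are available on Y. Halving norms along an iterated
    average gives long averages of blocks of norm at most 1, on which functionals
    of weight m_J have values of order 1 / m_J. A rapidly increasing sequence of
    n_J such averages has a sum of norm of order n_J / m_J that is already
    attained, up to a constant, by a functional of weight m_J. So the new norm
    distorts Y by a multiple of m_J. The upper bound for the sum only uses that
    an odd-weight functional is also an average of at most n_i successive members
    of the norming set. *)

Require Import Defs.
From HB Require Import structures.
From mathcomp Require Import all_boot all_order all_algebra.
From mathcomp Require Import finmap.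
From mathcomp Require Import all_classical all_reals all_analysis.
From mathcomp.multinomials Require Import -(notations) monalg.
From mathcomp Require Import zify ring lra.

Set Implicit Arguments.
Unset Strict Implicit.
Unset Printing Implicit Defensive.

Import Order.TTheory GRing.Theory Num.Theory.
Import numFieldNormedType.Exports.
Local Open Scope classical_set_scope.
Local Open Scope ring_scope.

(* mathcomp-analysis has another [restrict]. *)
Local Notation restrict := Defs.restrict.

(** * Finitely supported functionals: pairing, interval restrictions, blocks *)

Section Functionals.
Context {R : realType} {d : Order.disp_t} {W : orderType d}.
Implicit Types (phi psi x y : c00 W R) (J : interval W).

Lemma actE (E : {fset W}) phi x : (msupp phi `<=` E)%fset ->
  act phi x = \sum_(a <- E) mcoeff a phi * mcoeff a x.
Proof.
move=> sE; rewrite /act; apply: big_fset_incl => // a _ aphi.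
by rewrite mcoeff_outdom // mul0r.
Qed.

Lemma act_sym phi x : act phi x = act x phi.
Proof.
rewrite (@actE (msupp phi `|` msupp x)%fset) ?fsubsetUl //.
rewrite (@actE (msupp phi `|` msupp x)%fset) ?fsubsetUr //.
by apply: eq_bigr => a _; rewrite mulrC.
Qed.

Lemma act_is_linear phi : linear (act phi : c00 W R -> R).
Proof.
move=> c x y; rewrite /act scaler_sumr -big_split /=.
by apply: eq_bigr => a _; rewrite mcoeffD mcoeffZ mulrDr mulrCA.
Qed.

HB.instance Definition _ phi :=
  GRing.isLinear.Build R (c00 W R) R _ (act phi) (act_is_linear phi).

Lemma act_sumr (I : Type) (r : seq I) (P : pred I) (F : I -> c00 W R) phi :
  act phi (\sum_(i <- r | P i) F i) = \sum_(i <- r | P i) act phi (F i).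
Proof. exact: linear_sum. Qed.

Lemma actZr c phi x : act phi (c *: x) = c * act phi x.
Proof. exact: linearZ. Qed.

Lemma act_suml (I : Type) (r : seq I) (P : pred I) (F : I -> c00 W R) x :
  act (\sum_(i <- r | P i) F i) x = \sum_(i <- r | P i) act (F i) x.
Proof. by rewrite act_sym act_sumr; apply: eq_bigr => i _; rewrite act_sym. Qed.

Lemma actZl c phi x : act (c *: phi) x = c * act phi x.
Proof. by rewrite act_sym actZr act_sym. Qed.

Lemma act0l x : act (0 : c00 W R) x = 0.
Proof. by rewrite act_sym linear0. Qed.

Lemma actNl phi x : act (- phi) x = - act phi x.
Proof. by rewrite act_sym linearN /= act_sym. Qed.

Lemma mcoeff_basis (a b : W) : mcoeff b (basis_vec R a) = (a == b)%:R.
Proof. by rewrite /basis_vec mcoeffU. Qed.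

Lemma act_basisr phi (a : W) : act phi (basis_vec R a) = mcoeff a phi.
Proof.
rewrite act_sym (@actE [fset a]%fset) ?msuppU_le // big_seq_fset1.
by rewrite mcoeff_basis eqxx mul1r.
Qed.

Lemma act_basis (a : W) x : act (basis_vec R a) x = mcoeff a x.
Proof. by rewrite act_sym act_basisr. Qed.

Lemma mcoeff_restrict J phi (a : W) :
  mcoeff a (restrict J phi) = if a \in J then mcoeff a phi else 0.
Proof.
rewrite /restrict raddf_sum /= big_mkcond /=.
have [aphi|aphi] := boolP (a \in msupp phi); last first.
  rewrite mcoeff_outdom // if_same big_seq_cond big1 // => b /andP[bphi _].
  case: ifP => // _; rewrite mcoeffU; case: eqVneq => // E.
  by rewrite -E bphi in aphi.
rewrite (big_fsetD1 a) //= mcoeffU eqxx mulr1n [X in _ + X]big_seq.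
rewrite big1 ?addr0 // => b; rewrite !inE => /andP[/negPf ba _].
by rewrite mcoeffU ba if_same.
Qed.

Lemma restrict_is_linear J : linear (restrict J : c00 W R -> c00 W R).
Proof.
move=> c x y; apply/malgP => a.
rewrite mcoeffD mcoeffZ !mcoeff_restrict mcoeffD mcoeffZ.
by case: ifP => _ //; rewrite mulr0 addr0.
Qed.

HB.instance Definition _ J :=
  GRing.isLinear.Build R (c00 W R) (c00 W R) _ (restrict J)
    (restrict_is_linear J).

Lemma restrict_sum J (I : Type) (r : seq I) (P : pred I) (F : I -> c00 W R) :
  restrict J (\sum_(i <- r | P i) F i) = \sum_(i <- r | P i) restrict J (F i).
Proof. exact: linear_sum. Qed.

Lemma restrictZ J c phi : restrict J (c *: phi) = c *: restrict J phi.
Proof. exact: linearZ. Qed.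

Lemma restrictN J phi : restrict J (- phi) = - restrict J phi.
Proof. exact: linearN. Qed.

Lemma act_restrict J phi x : act (restrict J phi) x = act phi (restrict J x).
Proof.
rewrite (@actE (msupp phi)).
  rewrite (@actE (msupp phi)) //; apply: eq_bigr => a _.
  by rewrite !mcoeff_restrict; case: ifP; rewrite ?mulr0 ?mul0r.
apply/fsubsetP => a; rewrite -!mcoeff_neq0 mcoeff_restrict.
by case: ifP => //; rewrite eqxx.
Qed.

Lemma restrict_meet J J' phi :
  restrict J (restrict J' phi) = restrict (J `&` J')%O phi.
Proof.
apply/malgP => a; rewrite !mcoeff_restrict.
have -> : (a \in (J `&` J')%O) = (a \in J) && (a \in J') by exact: in_itvI.
by case: (a \in J); case: (a \in J').
Qed.

Lemma msupp_restrict J phi : (msupp (restrict J phi) `<=` msupp phi)%fset.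
Proof.
apply/fsubsetP => a; rewrite -!mcoeff_neq0 mcoeff_restrict.
by case: ifP => //; rewrite eqxx.
Qed.

Lemma block_map (f : c00 W R -> c00 W R) (s : seq (c00 W R)) :
  (forall phi, msupp (f phi) `<=` msupp phi)%fset ->
  block s -> block (map f s).
Proof.
move=> sub; rewrite /block pairwise_map; apply: sub_pairwise => phi psi /=.
move=> /allrelP lt; apply/allrelP => a b af bf.
by apply: lt; [apply: (fsubsetP (sub phi)) | apply: (fsubsetP (sub psi))].
Qed.

Lemma restrict_scaled_sum J m (s : seq (c00 W R)) :
  restrict J (scaled_sum m s) = scaled_sum m (map (restrict J) s).
Proof. by rewrite /scaled_sum restrictZ restrict_sum big_map. Qed.

(** The bound does not depend on [phi]; it makes the supremum defining the norm finite. *)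
Lemma act_ub phi x : (forall a, `|mcoeff a phi| <= 1) ->
  `|act phi x| <= \sum_(a <- msupp x) `|mcoeff a x|.
Proof.
move=> phi1; rewrite act_sym /act.
apply: le_trans (ler_norm_sum _ _ _) _; apply: ler_sum => a _.
by rewrite normrM -[leRHS]mulr1 ler_wpM2l.
Qed.

End Functionals.

(** * Induction over the norming set *)

Section NormingSet.
Context {R : realType} {d : Order.disp_t} {W : orderType d}.
Context {rho : W -> W -> nat} {sigma : triples nat R -> nat}.
Local Notation K := (@norming d W R rho sigma).
Implicit Types (phi psi x y : c00 W R) (J : interval W).

Scheme norming_mut := Minimality for norming Sort Prop
with has_weight_mut := Minimality for has_weight Sort Prop
with special_mut := Minimality for special Sort Prop.

(** What functionals of even and of odd weight have in common, with separation and coding forgotten.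
    As [s] may contain zero vectors, the notion survives restriction to intervals. *)
Definition decomposable i phi :=
  K phi /\ exists s : seq (c00 W R),
    [/\ forall psi, psi \in s -> K psi, block s, (size s <= n_ i)%N &
        phi = scaled_sum (m_ i) s].

Lemma special_norming_block j s : special rho sigma j s ->
  (forall phi, phi \in s -> K phi) /\ block s.
Proof. by case. Qed.

Lemma has_weight_decomposable w phi : has_weight rho sigma w phi ->
  exists i, [/\ (2 <= i)%N, w = m_ i & decomposable i phi].
Proof.
move=> h; have K1 := norming_weight h; case: h K1.
  move=> j s j1 s0 sK bs _ sz K1; exists (2 * j)%N; split => //; first lia.
  by split => //; exists s.
move=> j s j1 /special_norming_block[sK bs] _ sz K1.
by exists (2 * j).+1; split => //; [lia|split => //; exists s].
Qed.

Lemma decomposable_restrict i J phi :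
  decomposable i phi -> decomposable i (restrict J phi).
Proof.
move=> [Kphi [s [sK bs sz E]]]; split; first exact: norming_restrict.
exists (map (restrict J) s); split.
- by move=> _ /mapP[psi /sK ? ->]; exact: norming_restrict.
- by apply: block_map => // psi; exact: msupp_restrict.
- by rewrite size_map.
- by rewrite E restrict_scaled_sum.
Qed.

Lemma m_gt1 i : (1 < m_ i)%N.
Proof.
rewrite /m_; elim: i.-1 => //= k IH.
by rewrite (leq_trans IH) // -{1}[X in (X <= _)%N]expn1 leq_pexp2l // ltnW.
Qed.

(** At most one member of a block is nonzero at [a]. *)
Lemma block_mcoeff (s : seq (c00 W R)) (a : W) : block s ->
  (forall phi, phi \in s -> `|mcoeff a phi| <= 1) ->
  `|mcoeff a (\sum_(phi <- s) phi)| <= 1.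
Proof.
elim: s => [|phi s IH]; first by rewrite big_nil mcoeff0 normr0.
rewrite /block /= => /andP[lt bs] s1; rewrite big_cons mcoeffD.
have [aphi|aphi] := boolP (a \in msupp phi); last first.
  rewrite (mcoeff_outdom aphi) add0r; apply: IH => // psi psis.
  by apply: s1; rewrite inE psis orbT.
rewrite raddf_sum big_seq big1 ?addr0 => [|psi psis]; first exact/s1/mem_head.
apply: mcoeff_outdom; apply/negP => apsi.
by have /allrelP/(_ a a aphi apsi) := allP lt _ psis; rewrite ltxx.
Qed.

Lemma scaled_sum_mcoeff i (s : seq (c00 W R)) (a : W) : block s ->
  (forall phi, phi \in s -> `|mcoeff a phi| <= 1) ->
  `|mcoeff a (scaled_sum (m_ i) s)| <= (m_ i)%:R^-1.
Proof.
move=> bs s1; rewrite mcoeffZ normrM ger0_norm ?invr_ge0 //.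
rewrite -[leRHS]mulr1 ler_wpM2l ?invr_ge0 //; exact: block_mcoeff.
Qed.

Lemma m_inv_le1 i : (m_ i)%:R^-1 <= 1 :> R.
Proof. by rewrite invf_le1 ?ltr0n ?ler1n ltnW // m_gt1. Qed.

Lemma norming_mcoeff phi : K phi -> forall a, `|mcoeff a phi| <= 1.
Proof.
pose P (phi : c00 W R) := forall a, `|mcoeff a phi| <= 1.
(* In [weight_odd] the block property is available only through [special], so the predicate attached
   to [special] has to carry it. *)
pose Ps (s : seq (c00 W R)) := (forall phi, phi \in s -> P phi) /\ block s.
have PsP i s : Ps s -> P (scaled_sum (m_ i) s).
  move=> [sP bs] a; apply: le_trans (m_inv_le1 i).
  by apply: scaled_sum_mcoeff => // psi /sP.
apply: (@norming_mut d W R rho sigma P (fun _ => P) (fun _ => Ps)) => //.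
- by move=> b a; rewrite mcoeff_basis; case: eqP; rewrite ?normr0 ?normr1.
- by move=> psi _ IH a; rewrite mcoeffN normrN.
- by move=> J psi _ IH a; rewrite mcoeff_restrict; case: ifP; rewrite ?normr0.
- move=> n c f c0 c1 _ IH a; rewrite raddf_sum /=.
  apply: le_trans (ler_norm_sum _ _ _) _.
  have -> : 1 = \sum_(i < n) ratr (c i) :> R.
    by rewrite -rmorph_sum c1 rmorph1.
  apply: ler_sum => i _; rewrite mcoeffZ normrM ger0_norm ?ler0q //.
  by rewrite -[leRHS]mulr1 ler_wpM2l ?ler0q //; exact: IH.
- by move=> j s _ _ _ IH bs _ _; exact: PsP.
- by move=> j s _ _ IH _ _; exact: PsP.
Qed.

Lemma decomposable_mcoeff i phi (a : W) :
  decomposable i phi -> `|mcoeff a phi| <= (m_ i)%:R^-1.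
Proof.
move=> [_ [s [sK bs _ ->]]]; apply: scaled_sum_mcoeff => // psi /sK psiK.
exact: norming_mcoeff.
Qed.

(* Quantifying over restrictions makes the property stable under the
   restriction rule of the norming set. *)
Lemma norming_decomposable_ind (P : c00 W R -> Prop) :
  P 0 -> (forall a, P (basis_vec R a)) -> (forall phi, P phi -> P (- phi)) ->
  (forall n (c : 'I_n -> rat) (f : 'I_n -> c00 W R),
     (forall i, 0 <= c i) -> \sum_(i < n) c i = 1 ->
     (forall i, P (f i)) -> P (\sum_(i < n) ratr (c i) *: f i)) ->
  (forall i phi, (2 <= i)%N -> decomposable i phi -> P phi) ->
  forall phi, K phi -> P phi.
Proof.
move=> P0 Pe PN Pc Pd phi Kphi.
suff PJ : forall J, P (restrict J phi).
  have -> : phi = restrict `]-oo, +oo[ phi; last exact: PJ.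
  by apply/malgP => a; rewrite mcoeff_restrict in_itv.
elim: Kphi => {phi}.
- move=> a J; have [aJ|aJ] := boolP (a \in J).
    rewrite (_ : restrict _ _ = basis_vec R a) //; apply/malgP => b.
    rewrite mcoeff_restrict mcoeff_basis.
    by case: eqP => [<-|]; rewrite ?aJ ?if_same.
  rewrite (_ : restrict _ _ = 0) //; apply/malgP => b.
  rewrite mcoeff_restrict mcoeff_basis mcoeff0; case: eqP => [<-|].
    by rewrite (negPf aJ).
  by rewrite if_same.
- by move=> phi _ IH J; rewrite restrictN; exact/PN/IH.
- by move=> J' phi _ IH J; rewrite restrict_meet; exact: IH.
- move=> w phi /has_weight_decomposable[i [i2 _ dphi]] J.
  exact/(Pd i)/decomposable_restrict.
- move=> n c f c0 c1 _ IH J; rewrite restrict_sum.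
  rewrite (eq_bigr (fun i => ratr (c i) *: restrict J (f i))) => [|i _].
    by apply: Pc => // i; exact: IH.
  by rewrite restrictZ.
Qed.

End NormingSet.

(** * Growth of the parameters *)

Lemma mE i : m_ i = (2 ^ 4 ^ i.-1)%N.
Proof.
by rewrite /m_; elim: i.-1 => //= k ->; rewrite -expnM -expnSr.
Qed.

Lemma leq_m i j : (i <= j)%N -> (m_ i <= m_ j)%N.
Proof. by move=> ij; rewrite !mE leq_exp2l // leq_pexp2l //; lia. Qed.

(** Positivity is required because the indices 0 and 1 both give the value 2. *)
Lemma m_inj i j : (0 < i)%N -> (0 < j)%N -> m_ i = m_ j -> i = j.
Proof.
by rewrite !mE => i0 j0 /eqP; rewrite eqn_exp2l // eqn_exp2l // => /eqP; lia.
Qed.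

Lemma ltn_m i : (i < m_ i.+1)%N.
Proof.
rewrite mE succnK; apply: (leq_trans (ltn_expl i (isT : (1 < 4)%N))).
exact/ltnW/ltn_expl.
Qed.

Lemma nSS i : n_ i.+2 = ((4 * n_ i.+1) ^ (3 * 4 ^ i.+1))%N.
Proof.
have -> : n_ i.+2 = ((4 * n_ i.+1) ^ trunc_log 2 (m_ i.+2 ^ 3))%N by [].
by rewrite mE -expnM (mulnC _ 3%N) trunc_expnK.
Qed.

Lemma n_gt0 i : (0 < n_ i)%N.
Proof. by rewrite /n_; elim: i.-1 => //= k IH; rewrite expn_gt0 muln_gt0 IH. Qed.

Lemma leq_nS i : (n_ i <= n_ i.+1)%N.
Proof.
case: i => [|i]; first by [].
rewrite nSS -{1}[n_ i.+1]expn1 (@leq_trans ((4 * n_ i.+1) ^ 1)%N) //.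
  by rewrite leq_exp2r // leq_pmull.
by apply: leq_pexp2l; rewrite ?muln_gt0 ?n_gt0 ?expn_gt0.
Qed.

Lemma leq_n i j : (i <= j)%N -> (n_ i <= n_ j)%N.
Proof. by apply: (homo_leq leqnn leq_trans); exact: leq_nS. Qed.

(** * Estimates on averages and on rapidly increasing sequences *)

Section Estimates.
Context {R : realType} {d : Order.disp_t} {W : orderType d}.
Context {rho : W -> W -> nat} {sigma : triples nat R -> nat}.
Local Notation K := (@norming d W R rho sigma).
Local Notation decomposable := (@decomposable R d W rho sigma).
Implicit Types (phi psi x y : c00 W R) (s : seq (c00 W R)).

(** The closed unit ball of the norm induced by [K], expressed without the completion. *)
Definition dual_ball x := forall phi, K phi -> `|act phi x| <= 1.

Definition block_fun {n} (x : 'I_n -> c00 W R) :=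
  forall i k : 'I_n, (i < k)%N -> supp_lt (x i) (x k).

Definition meets phi x := ~~ [disjoint msupp phi & msupp x]%fset.

Lemma meetsP phi x :
  reflect (exists2 a, a \in msupp phi & a \in msupp x) (meets phi x).
Proof.
apply: (iffP idP) => [|[a aphi ax]].
  rewrite /meets -fsetI_eq0 => /fset0Pn[a]; rewrite inE => /andP[]; by exists a.
by rewrite /meets -fsetI_eq0; apply/fset0Pn; exists a; rewrite inE aphi.
Qed.

Lemma act_meets0 phi x : ~~ meets phi x -> act phi x = 0.
Proof.
move=> nm; rewrite /act big_seq big1 // => a aphi.
have [ax|ax] := boolP (a \in msupp x); last by rewrite (mcoeff_outdom ax) mulr0.
by case/meetsP: nm; exists a.
Qed.

(* The members of [D] are the vectors met by two of the functionals: sending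
   such a vector to the first functional meeting it is injective. *)
Lemma block_split s n (x : 'I_n -> c00 W R) : block s -> block_fun x ->
  exists (D : {set 'I_n}) (sel : 'I_n -> nat), (#|D| <= size s)%N /\
    forall k, k \notin D -> forall j, (j < size s)%N -> j <> sel k ->
      act s`_j (x k) = 0.
Proof.
move=> bs bx.
have [sel selE] : exists sel, forall k, sel k = find (meets^~ (x k)) s.
  by exists (fun k => find (meets^~ (x k)) s).
pose D := finset (fun k => has (meets^~ (x k)) (drop (sel k).+1 s)).
exists D, sel; split; last first.
  move=> k; rewrite inE => nD j js jsel; apply: act_meets0.
  have [lt|gt|//] := ltngtP j (sel k).
    by rewrite selE in lt; rewrite (before_find 0 lt).
  apply: contra nD => mj; apply/hasP; exists s`_j => //.
  rewrite -(subnKC gt) -nth_drop mem_nth // size_drop.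
  by rewrite ltn_sub2r // (leq_ltn_trans gt).
have DP k : k \in D -> exists j, [/\ (sel k < j)%N, (j < size s)%N &
    meets s`_j (x k)].
  rewrite inE => /(has_nthP 0)[j]; rewrite size_drop nth_drop ltn_subRL => jlt mj.
  by exists ((sel k).+1 + j)%N; split => //; rewrite leq_addr.
have selP k : k \in D -> meets s`_(sel k) (x k).
  move=> kD; rewrite selE; apply: (@nth_find _ 0 (meets^~ (x k))).
  have [j [lt js mj]] := DP k kD; apply/(has_nthP 0); by exists j.
have sinj : {in D &, injective sel}.
  (* If [sel k] and [sel k'] agreed, a point of [x k'] in that functional would precede a point of
     [x k] in a later functional, against [block_fun x]. *)
  have aux k k' : k \in D -> k' \in D -> (k < k')%N -> sel k <> sel k'.
    move=> kD k'D lt E.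
    have [j [ltj js /meetsP[a aj ak]]] := DP k kD.
    have /meetsP[b bs' bk] := selP k' k'D.
    have := allrelP (bx _ _ lt) _ _ ak bk; move/lt_trans.
    have : supp_lt s`_(sel k) s`_j.
      by move/pairwiseP: bs => /(_ 0); apply; rewrite ?inE // (ltn_trans ltj).
    move/allrelP/(_ b a); rewrite E => /(_ bs' aj) ba /(_ _ ba).
    by rewrite ltxx.
  move=> k k' kD k'D E; have [lt|lt|/val_inj//] := ltngtP k k'.
    by case: (aux _ _ kD k'D lt).
  by case: (aux _ _ k'D kD lt).
rewrite cardE -(size_map sel) -(size_iota 0 (size s)); apply: uniq_leq_size.
  rewrite map_inj_in_uniq ?enum_uniq // => k k'; rewrite !mem_enum.
  exact: sinj.
move=> j /mapP[k]; rewrite mem_enum mem_iota add0n /= => /DP[j' [lt js _]] ->.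
exact: ltn_trans js.
Qed.

Lemma act_scaled_sum m s x :
  act (scaled_sum m s) x = m%:R^-1 * \sum_(j < size s) act s`_j x.
Proof. by rewrite /scaled_sum actZl act_suml (big_nth 0) big_mkord. Qed.

(** These are the $\ell_1$-averages of length [L]; lower bounds on their norm are imposed
    separately. *)
Definition is_average L x := exists z : 'I_L -> c00 W R,
  [/\ block_fun z, forall i, dual_ball (z i) & x = L%:R^-1 *: \sum_i z i].

Lemma average_dual_ball L x : is_average L x -> dual_ball x.
Proof.
move=> [z [_ zb ->]] phi Kphi; rewrite actZr act_sumr.
rewrite normrM ger0_norm ?invr_ge0 //.
(* For [L] zero the inverse is zero by convention, and so is the average. *)
have [L0|L0] := posnP L.
  by have -> : L%:R^-1 = 0 :> R; [rewrite L0 invr0 | rewrite mul0r].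
rewrite mulrC ler_pdivrMr ?ltr0n // mul1r.
apply: le_trans (ler_norm_sum _ _ _) _.
have -> : L%:R = \sum_(i < L) 1 :> R by rewrite sumr_const card_ord.
by apply: ler_sum => i _; exact: zb.
Qed.

(** By [block_split], all but at most [n_ i] of the [L] vectors see a single functional and
    contribute at most 1 / [m_ i] each; the others contribute at most 1 each, and [n_ i] is at most
    [L] / [m_ i]. *)
Lemma average_decomposable L x i phi : is_average L x -> decomposable i phi ->
  (n_ i * m_ i <= L)%N -> `|act phi x| <= 2 / (m_ i)%:R.
Proof.
move=> [z [bz zb ->]] [Kphi [s [sK bs sz phiE]]] Lbig.
have m0 : 0 < (m_ i)%:R :> R by rewrite ltr0n ltnW // m_gt1.
have L0 : (0 < L)%N.
  by apply: leq_trans Lbig; rewrite muln_gt0 n_gt0 ltnW // m_gt1.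
have [D [sel [cD dD]]] := block_split bs bz.
rewrite actZr act_sumr normrM ger0_norm ?invr_ge0 // mulrC.
rewrite ler_pdivrMr ?ltr0n //; apply: le_trans (ler_norm_sum _ _ _) _.
have bnd k : `|act phi (z k)| <= (m_ i)%:R^-1 + (k \in D)%:R.
  have [kD|kD] := boolP (k \in D).
    by rewrite -[leLHS]add0r lerD ?invr_ge0 ?zb.
  rewrite addr0 phiE act_scaled_sum normrM ger0_norm ?invr_ge0 //.
  rewrite -[leRHS]mulr1 ler_wpM2l ?invr_ge0 //.
  have [ss|ss] := ltnP (sel k) (size s); last first.
    rewrite big1 ?normr0 // => j _; apply: dD => // E.
    by have := ltn_ord j; rewrite E ltnNge ss.
  rewrite (bigD1 (Ordinal ss)) //= big1 => [|j /eqP jE].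
    by rewrite addr0; apply: (zb k); apply: sK; rewrite mem_nth.
  by apply: dD => // E; apply: jE; apply: val_inj.
apply: le_trans (ler_sum _ (fun k _ => bnd k)) _.
have sumD : (\sum_(k < L) (k \in D) = #|D|)%N.
  by rewrite -sum1_card [RHS]big_mkcond; apply: eq_bigr => k _; case: (k \in D).
rewrite big_split /= sumr_const card_ord -[_^-1 *+ L]mulr_natl -natr_sum sumD.
apply: (@le_trans _ _ (L%:R / (m_ i)%:R + (n_ i)%:R)).
  by rewrite lerD2l ler_nat (leq_trans cD).
have nL : (n_ i)%:R <= L%:R / (m_ i)%:R :> R.
  by rewrite ler_pdivlMr // -natrM ler_nat.
have -> : 2 / (m_ i)%:R * L%:R = L%:R / (m_ i)%:R + L%:R / (m_ i)%:R :> R.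
  by ring.
by rewrite lerD2l.
Qed.

(** Coefficients of [phi] are at most 1 / [m_ i] and those of [x] at most 1. This serves for weights
    that are huge compared with the support of [x]. *)
Lemma decomposable_small_supp x i phi : dual_ball x -> decomposable i phi ->
  `|act phi x| <= #|` msupp x|%:R / (m_ i)%:R.
Proof.
move=> xb dphi; rewrite act_sym /act; apply: le_trans (ler_norm_sum _ _ _) _.
rewrite -sum1_size natr_sum mulr_suml; apply: ler_sum => a _.
rewrite normrM ler_pM ?(decomposable_mcoeff a dphi) //.
by rewrite -act_basis; apply: xb; exact: norming_basis.
Qed.

(* A functional of weight m_i with i < J splits at most n_(J-1) vectors and gains
   a factor 1 / m_i <= 1 / 2 on the others, whence the induction on r; weights
   from m_J on give the final bound at once. *)
Lemma ris_bound J n (x : 'I_n -> c00 W R) : (2 <= J)%N ->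
  block_fun x -> (forall k, dual_ball (x k)) ->
  (forall i phi, (J <= i)%N -> decomposable i phi -> exists k0 : nat,
     forall k : 'I_n, k <> k0 :> nat -> `|act phi (x k)| <= 2 / (m_ J)%:R) ->
  forall r, (2 ^ r <= m_ J)%N -> forall phi, K phi -> forall I : {set 'I_n},
  `|\sum_(k in I) act phi (x k)| <=
    2 * #|I|%:R / (2 ^ r)%:R + ((4 * n_ J.-1) ^ r)%:R.
Proof.
move=> J2 bx xb high; elim=> [_ phi Kphi I|r IH rJ].
  rewrite !expn0 divr1; apply: le_trans (ler_norm_sum _ _ _) _.
  apply: (@le_trans _ _ #|I|%:R); last first.
    by rewrite mulr2n mulrDl !mul1r -addrA lerDl addr_ge0.
  by rewrite -sumr_const; apply: ler_sum => k _; exact: xb.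
have {}IH := IH (leq_trans (leq_pexp2l (isT : (0 < 2)%N) (leqnSn r)) rJ).
set q := (4 * n_ J.-1)%N in IH *.
have q1 t : 1 <= (q ^ t)%:R :> R.
  by rewrite ler1n expn_gt0 muln_gt0 n_gt0.
have B1 (I : {set 'I_n}) :
    1 <= 2 * #|I|%:R / (2 ^ r.+1)%:R + (q ^ r.+1)%:R :> R.
  by rewrite -[leLHS]add0r lerD // divr_ge0 // mulr_ge0.
apply: norming_decomposable_ind.
- move=> I; rewrite big1 ?normr0 => [|k _]; last exact: act0l.
  exact: le_trans (B1 I).
- move=> a I; apply: le_trans (B1 I).
  have [[k ak]|nk] := pselect (exists k, a \in msupp (x k)); last first.
    rewrite big1 ?normr0 // => k _; rewrite act_basis mcoeff_outdom //.
    by apply/negP => ak; apply: nk; exists k.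
  have z k' : k' != k -> act (basis_vec R a) (x k') = 0.
    move=> k'k; rewrite act_basis mcoeff_outdom //; apply/negP => ak'.
    have [lt|lt|/val_inj E] := ltngtP k' k; last by rewrite E eqxx in k'k.
      by have := allrelP (bx _ _ lt) _ _ ak' ak; rewrite ltxx.
    by have := allrelP (bx _ _ lt) _ _ ak ak'; rewrite ltxx.
  have [kI|kI] := boolP (k \in I).
    rewrite (bigD1 k) //= big1 ?addr0; last by move=> k' /andP[_ /z].
    by apply: xb; exact: norming_basis.
  rewrite big1 ?normr0 // => k' k'I; apply: z.
  by apply: contra kI => /eqP <-.
- move=> phi IHphi I; rewrite (eq_bigr (fun k => - act phi (x k))).
    by rewrite sumrN normrN.
  by move=> k _; exact: actNl.
- move=> N c f c0 c1 IHf I.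
  rewrite (eq_bigr (fun k => \sum_(i < N) ratr (c i) * act (f i) (x k))).
    rewrite exchange_big /=; apply: le_trans (ler_norm_sum _ _ _) _.
    set b := leRHS; rewrite -[b]mul1r.
    have -> : 1 = \sum_(i < N) ratr (c i) :> R.
      by rewrite -rmorph_sum c1 rmorph1.
    rewrite mulr_suml; apply: ler_sum => i _; rewrite -mulr_sumr normrM.
    by rewrite ger0_norm ?ler0q // ler_wpM2l ?ler0q //; exact: IHf.
  by move=> k _; rewrite act_suml; apply: eq_bigr => i _; rewrite actZl.
move=> i phi i2 dphi I; have [Ji|iJ] := leqP J i.
  (* The values other than the one at [k0] are at most 2 / [m_ J], hence at most 2 / 2^(r+1); the
     one at [k0] costs at most 1, absorbed by the second term. *)
  have [k0 k0P] := high i phi Ji dphi.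
  apply: le_trans (ler_norm_sum _ _ _) _.
  have bnd k : `|act phi (x k)| <= 2 / (m_ J)%:R + (k == k0 :> nat)%:R.
    have [E|/eqP nE] := eqVneq (k : nat) k0; last by rewrite addr0 k0P.
    rewrite -[leLHS]add0r lerD ?divr_ge0 // xb //; by case: dphi.
  apply: le_trans (ler_sum _ (fun k _ => bnd k)) _.
  rewrite big_split /=; apply: lerD.
    rewrite sumr_const -[leLHS]mulr_natl mulrCA mulrA ler_wpM2l ?mulr_ge0 //.
    rewrite lef_pV2 ?posrE ?ltr0n ?expn_gt0 ?ler_nat //.
    by rewrite ltnW // m_gt1.
  apply: le_trans (q1 r.+1); rewrite -natr_sum lern1.
  rewrite (eq_bigr (fun k : 'I_n => if k == k0 :> nat then 1 else 0)%N); last first.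
    by move=> k _; case: eqP.
  rewrite -big_mkcondr sum1_card.
  apply/card_le1_eqP => k k' /andP[_ /eqP kE] /andP[_ /eqP k'E].
  by apply: val_inj; rewrite /= kE k'E.
have [Kphi [s [sK bs sz phiE]]] := dphi.
have [D [sel [cD dD]]] := block_split bs bx.
have iJn : (n_ i <= n_ J.-1)%N by apply: leq_n; rewrite -ltnS prednK // ltnW.
rewrite (bigID (mem D)) /=; apply: le_trans (ler_normD _ _) _.
have bD : `|\sum_(k in I | k \in D) act phi (x k)| <= (n_ J.-1)%:R.
  apply: le_trans (ler_norm_sum _ _ _) _.
  apply: (@le_trans _ _ (\sum_(k in I | k \in D) 1)).
    by apply: ler_sum => k _; exact: xb.
  rewrite sumr_const ler_nat (leq_trans _ iJn) // (leq_trans _ sz) //.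
  apply: leq_trans cD; apply: subset_leq_card; apply/fintype.subsetP => k.
  by move=> /andP[].
pose I_ (j : 'I_(size s)) :=
  finset (fun k => [&& k \in I, k \notin D & sel k == j]).
have EI : \sum_(k in I | k \notin D) act phi (x k) =
    (m_ i)%:R^-1 * \sum_(j < size s) \sum_(k in I_ j) act s`_j (x k).
  rewrite phiE (eq_bigr _ (fun k _ => act_scaled_sum _ _ _)) -mulr_sumr.
  congr (_ * _); rewrite exchange_big /=; apply: eq_bigr => j _.
  rewrite (bigID (fun k => sel k == j)) /= [X in _ + X]big1 ?addr0.
    by apply: eq_bigl => k; rewrite inE andbA.
  by move=> k /andP[/andP[_ kD] /eqP kj]; apply: dD => // E; apply: kj.
have cI : (\sum_(j < size s) #|I_ j| <= #|I|)%N.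
  rewrite (eq_bigr (fun j => \sum_(k in I_ j) 1)%N); last first.
    by move=> j _; rewrite sum1_card.
  rewrite (eq_bigr (fun j : 'I_(size s) =>
    \sum_(k in I | (k \notin D) && (sel k == j)) 1)%N); last first.
    by move=> j _; apply: eq_bigl => k; rewrite inE.
  rewrite (exchange_big_dep (mem I)) /=; last by move=> j k _ /andP[].
  rewrite -sum1_card; apply: leq_sum => k _; rewrite sum1_card.
  apply/card_le1_eqP => j j' /andP[_ /andP[_ /eqP jE]].
  move=> /andP[_ /andP[_ /eqP j'E]].
  by apply: val_inj; rewrite /= -j'E -jE.
have bI : `|\sum_(k in I | k \notin D) act phi (x k)| <=
    2^-1 * (2 * #|I|%:R / (2 ^ r)%:R + (n_ J.-1)%:R * (q ^ r)%:R).
  rewrite EI normrM ger0_norm ?invr_ge0 // ler_pM ?invr_ge0 //.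
    by rewrite lef_pV2 ?posrE ?ltr0n ?ler_nat // ?m_gt1 // ltnW // m_gt1.
  apply: le_trans (ler_norm_sum _ _ _) _.
  apply: (@le_trans _ _ (\sum_(j < size s)
      (2 * #|I_ j|%:R / (2 ^ r)%:R + (q ^ r)%:R))).
    by apply: ler_sum => j _; apply: IH; apply: sK; rewrite mem_nth.
  rewrite big_split /= sumr_const card_ord; apply: lerD.
    rewrite -mulr_suml -mulr_sumr -natr_sum ler_wpM2r ?invr_ge0 //.
    by rewrite ler_wpM2l ?ler_nat.
  by rewrite -[leLHS]mulr_natl ler_wpM2r // ler_nat (leq_trans sz).
apply: le_trans (lerD bD bI) _.
have -> : 2 * #|I|%:R / (2 ^ r.+1)%:R = 2^-1 * (2 * #|I|%:R / (2 ^ r)%:R) :> R.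
  by rewrite expnS natrM invfM; ring.
have -> : (q ^ r.+1)%:R = 4 * (n_ J.-1)%:R * (q ^ r)%:R :> R.
  by rewrite expnS natrM {1}/q natrM.
(* With n = [n_ J.-1], the terms n and n q^r / 2 fit together into q^(r+1) = 4 n q^r because q^r is
   at least 1. *)
have : 0 <= (n_ J.-1)%:R * ((q ^ r)%:R - 1) :> R.
  by rewrite mulr_ge0 // subr_ge0.
have : 0 <= (n_ J.-1)%:R :> R by [].
lra.
Qed.

End Estimates.

(** * Selection of separated blocks along $\omega_1$ *)

Section Selection.
Context {d : Order.disp_t} {W : orderType d} (hW : is_omega1 W).
Context (rho : W -> W -> nat) (hrho : rho_function rho).

Lemma countable_setU (U : Type) (A B : set U) :
  countable A -> countable B -> countable (A `|` B).
Proof.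
move=> cA cB; have -> : A `|` B = \bigcup_b (if b then A else B).
  apply/seteqP; split => [x [Ax|Bx]|x [[] _ h]];
    by [exists true|exists false|left|right].
by apply: bigcup_countable => // -[].
Qed.

Lemma countable_range (I : countType) (U : Type) (f : I -> U) :
  countable (range f).
Proof. exact: sub_countable (card_image_le _ _) (countableP _). Qed.

(** A countable cofinal set would make [W] a countable union of countable initial segments. *)
Lemma omega1_bounded (A : set W) : countable A ->
  exists b, forall a, A a -> (a < b)%O.
Proof.
move=> cA; apply: contrapT => unb; apply: (omega1_uncountable hW).
apply: (@sub_countable _ _ _
  (\bigcup_(a in A) ([set b | (b < a)%O] `|` [set a]))).
  apply: subset_card_le => b _; apply: contrapT => nb; apply: unb; exists b.
  move=> a Aa; rewrite ltNge le_eqVlt; apply/negP => /orP ba; apply: nb.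
  by exists a => //; case: ba => [/eqP ->|ba]; [right|left].
apply: bigcup_countable => // a _.
exact: countable_setU (omega1_initial hW a) (countable1 a).
Qed.

Context {T : Type} (supp : T -> {fset W}).

Definition above (b : W) (F : {fset W}) := forall a, a \in F -> (b < a)%O.

(** This plays the role of an uncountable family of blocks: members remain beyond every countable
    ordinal. *)
Definition supply (P : T -> Prop) := forall b, exists t, P t /\ above b (supp t).

Lemma omega1_fset_bounded (b : W) (F : {fset W}) :
  exists c, (b < c)%O /\ forall a, a \in F -> (a < c)%O.
Proof.
have [c cP] := omega1_bounded (countable_fset (b |` F)%fset).
by exists c; split => [|a aF]; apply: cP => /=; rewrite !inE ?eqxx ?aF ?orbT.
Qed.

(** Otherwise each [S] has a point beyond which all supports have more than [S] elements, and a
    member beyond all these points contradicts its own size. A uniform bound allows the required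
    separation to be fixed before the members are chosen. *)
Lemma supply_card_bounded P : supply P ->
  exists S, supply (fun t => P t /\ (#|` supp t| <= S)%N).
Proof.
move=> sP; apply: contrapT => nS.
have /choice[b bP] : forall S, exists b, forall t, P t -> above b (supp t) ->
    (S < #|` supp t|)%N.
  move=> S; apply: contrapT => nb; apply: nS; exists S => b.
  apply: contrapT => nt; apply: nb; exists b => t Pt bt.
  by rewrite ltnNge; apply/negP => tS; apply: nt; exists t.
have [c cP] := @omega1_bounded (range b) (countable_range _).
have [t [Pt ct]] := sP c.
have : above (b #|` supp t|) (supp t).
  by move=> a /ct; apply: lt_trans; apply: cP; exists #|` supp t|.
by move/(bP _ _ Pt); rewrite ltnn.
Qed.

(* Infinitely many candidates for the first member are fixed before the others
   are chosen by induction above all of them: only finitely many points have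
   small distance to the later members. *)
Lemma separated_selection (P : nat -> T -> Prop) : (forall k, supply (P k)) ->
  forall p n b, exists t : nat -> T,
    (forall k, (k < n)%N -> P k (t k) /\ above b (supp (t k))) /\
    (forall i k, (i < k < n)%N -> forall a a', a \in supp (t i) ->
      a' \in supp (t k) -> (a < a')%O /\ (p <= rho a a')%N).
Proof.
move=> + p n; elim: n P => [|n IH] P sP b.
  have [t _] := sP 0%N b; exists (fun _ => t).
  by split => // i k; rewrite ltn0 andbF.
have [f fP] := choice (sP 0%N).
have [g gP] := choice (fun c => omega1_fset_bounded c (supp (f c))).
(* The candidates [t i] lie between [c i] and [c i.+1], so they form a block. *)
pose c i := iter i g b; pose t i := f (c i).
have cS i : (c i < c i.+1)%O by have [] := gP (c i).
have c_mono : {homo c : i j / (i < j)%N >-> (i < j)%O}.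
  by apply: homo_ltn => // ? ? ?; exact: lt_trans.
have c_mono' : {homo c : i j / (i <= j)%N >-> (i <= j)%O}.
  apply: homo_leq => [//|? ? ?|i]; [exact: le_trans|exact: ltW (cS i)].
have [e eP] := @omega1_bounded (range c) (countable_range _).
have [u [uP usep]] := IH (fun k => P k.+1) (fun k => sP k.+1) e.
pose bad := \bigcup_(k in `I_n) \bigcup_(a' in [set` supp (u k)])
  [set a | (a < a')%O && (rho a a' <= p)%N].
have fin_bad : finite_set bad.
  apply: bigcup_finite => // k _; apply: bigcup_finite => // a' _.
  exact: rho_finite.
(* Otherwise a choice of one bad point in each candidate would be a strictly increasing sequence in
   a finite set. *)
have [i iP] : exists i, forall a, a \in supp (t i) -> ~ bad a.
  apply: contrapT => nex.
  have /choice[a aP] : forall i, exists a, a \in supp (t i) /\ bad a.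
    move=> i; apply: contrapT => na; apply: nex; exists i => a ati bada.
    by apply: na; exists a.
  have a_mono i j : (i < j)%N -> (a i < a j)%O.
    move=> ij; have [ai _] := aP i; have [aj _] := aP j.
    apply: (@lt_le_trans _ _ (c i.+1)); first by have [_] := gP (c i); apply.
    apply: le_trans (c_mono' _ _ ij) _.
    by have [_ /(_ _ aj)/ltW] := fP (c j).
  apply: infinite_nat.
  have -> : [set: nat] = a @^-1` bad.
    by apply/seteqP; split => // i _; have [] := aP i.
  apply: finite_preimage fin_bad => i j _ _ E.
  by have [/a_mono|/a_mono|//] := ltngtP i j; rewrite E ltxx.
exists (fun k => if k is k'.+1 then u k' else t i); split.
  move=> [_|k kn]; last first.
    have [Pk ek] := uP k kn; split => // a /ek; apply: lt_trans.
    by apply: eP; exists 0%N.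
  have [Pt ct] := fP (c i); split => // a /ct; apply: le_lt_trans.
  exact: (c_mono' 0%N i).
move=> [|j] [|k] // jk a a' aj a'k; last by apply: usep a'k => //; lia.
have kn : (k < n)%N by lia.
have aa' : (a < a')%O.
  have [_ /(_ _ a'k)] := uP k kn; apply: lt_trans.
  have [_ /(_ _ aj) h] := gP (c i); apply: lt_trans h _.
  by apply: eP; exists i.+1.
split => //; rewrite leqNgt; apply/negP => lt; apply: (iP a aj).
by exists k => //; exists a' => //=; rewrite aa' ltnW.
Qed.

End Selection.

(** * Functionals of even weight on separated blocks *)

Section Weighted.
Context {R : realType} {d : Order.disp_t} {W : orderType d} (hW : is_omega1 W).
Context (rho : W -> W -> nat) (hrho : rho_function rho).
Context {sigma : triples nat R -> nat}.
Local Notation K := (@norming d W R rho sigma).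
Local Notation dual_ball := (@dual_ball R d W rho sigma).
Local Notation decomposable := (@decomposable R d W rho sigma).
Local Notation is_average := (@is_average R d W rho sigma).
Local Notation pair := (c00 W R * c00 W R)%type.

(** A pair is a vector with a functional norming it; the joint support lets both be separated at
    once. *)
Definition psupp (t : pair) : {fset W} := (msupp t.1 `|` msupp t.2)%fset.

Lemma card_supports_le (s : seq (c00 W R)) :
  (#|` supports s| <= \sum_(phi <- s) #|` msupp phi|)%N.
Proof.
rewrite /supports; elim: s => [|phi s IH]; first by rewrite !big_nil cardfs0.
rewrite !big_cons (leq_trans (leq_card_fsetU _ _)) //.
by rewrite leq_add2l.
Qed.

(** Separation by the sum of the bounds [S k], which dominates the size of the union of the
    supports, makes [weight_even] applicable. The joint supports being disjoint, each functional
    sees only its own vector and the double sum reduces to its diagonal. *)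
Lemma weighted_selection (P : nat -> pair -> Prop) (S : nat -> nat) j n :
  (forall k, supply psupp (P k)) ->
  (forall k t, P k t -> K t.2 /\ (#|` psupp t| <= S k)%N) ->
  (0 < j)%N -> (0 < n <= n_ (2 * j))%N ->
  forall b, exists t : nat -> pair,
   [/\ forall k, (k < n)%N -> P k (t k) /\ above b (psupp (t k)),
       forall i k, (i < k < n)%N -> supp_lt (t i).1 (t k).1 &
       exists2 phi, has_weight rho sigma (m_ (2 * j)) phi &
        act phi (\sum_(k < n) (t k).1) =
        (m_ (2 * j))%:R^-1 * \sum_(k < n) act (t k).2 (t k).1].
Proof.
move=> sP PS j0 /andP[n0 nj] b.
have [t [tP tsep]] :=
  separated_selection hW hrho sP (\sum_(k < n) S k)%N n b.
have supp1 k a : a \in msupp (t k).1 -> a \in psupp (t k).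
  by move=> ak; rewrite inE ak.
have supp2 k a : a \in msupp (t k).2 -> a \in psupp (t k).
  by move=> ak; rewrite inE ak orbT.
exists t; split => //.
  move=> i k ik; apply/allrelP => a a' ai a'k.
  by have [] := tsep i k ik a a' (supp1 _ _ ai) (supp1 _ _ a'k).
pose s := mkseq (fun k => (t k).2) n.
have szs : size s = n by rewrite size_mkseq.
have sE k : (k < n)%N -> s`_k = (t k).2 by move=> kn; rewrite nth_mkseq.
exists (scaled_sum (m_ (2 * j)) s).
  apply: weight_even => //.
  - by rewrite -size_eq0 szs -lt0n.
  - by move=> phi /mapP[k]; rewrite mem_iota => /tP[/PS[]] Kk _ _ ->.
  - apply/(pairwiseP 0) => i k; rewrite !inE szs => im km ik.
    rewrite !sE //; apply/allrelP => a a' ai a'k.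
    have ikn : (i < k < n)%N by rewrite ik.
    by have [] := tsep i k ikn a a' (supp2 _ _ ai) (supp2 _ _ a'k).
  - have le_p : (#|` supports s| <= \sum_(k < n) S k)%N.
      apply: leq_trans (card_supports_le s) _.
      rewrite /s big_map -[in iota _ _](subn0 n) big_mkord.
      apply: leq_sum => k _; have [/PS[_ Sk] _] := tP k (ltn_ord k).
      by apply: leq_trans Sk; apply: fsubset_leq_card; exact: fsubsetUr.
    move=> i k; rewrite szs => im km ik; rewrite !sE //.
    apply/allrelP => a a' ai a'k; apply: leq_trans le_p _.
    have [lt|lt|//] := ltngtP i k.
      have ikn : (i < k < n)%N by rewrite lt.
      by have [] := tsep i k ikn a a' (supp2 _ _ ai) (supp2 _ _ a'k).
    have ikn : (k < i < n)%N by rewrite lt.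
    rewrite (rho_sym hrho).
    by have [] := tsep k i ikn a' a (supp2 _ _ a'k) (supp2 _ _ ai).
  - by rewrite szs.
rewrite act_scaled_sum szs; congr (_ * _); apply: eq_bigr => k _.
rewrite sE // act_sumr (bigD1 k) //= big1 ?addr0 // => i ik.
apply: act_meets0; apply/meetsP => -[a ak ai].
have [lt|lt|/val_inj E] := ltngtP k i; last by rewrite E eqxx in ik.
  have kin : (k < i < n)%N by rewrite lt ltn_ord.
  by have [] := tsep k i kin a a (supp2 _ _ ak) (supp1 _ _ ai); rewrite ltxx.
have kin : (i < k < n)%N by rewrite lt ltn_ord.
by have [] := tsep i k kin a a (supp1 _ _ ai) (supp2 _ _ ak); rewrite ltxx.
Qed.

(** A functional of index i below [l k] sees [x k] as a long average; if i is at least [l k.+1], the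
    support of [x k] is small for it. As [l] is monotone, at most one [k] escapes both cases, as
    [ris_bound] requires. *)
Lemma ris_average_bound J (x : 'I_(n_ J) -> c00 W R) (L S l : nat -> nat) :
  (2 <= J)%N -> block_fun x ->
  (forall k : 'I_(n_ J), is_average (L k) (x k)) ->
  (forall k : 'I_(n_ J), (#|` msupp (x k)| <= S k)%N) ->
  (forall k i, (i < l k)%N -> (n_ i * m_ i <= L k)%N) ->
  (forall k, (l k <= l k.+1)%N) ->
  (forall k, (S k * m_ J <= m_ (l k.+1))%N) ->
  forall phi, K phi ->
    `|act phi (\sum_k x k)| <= 3 * (n_ J)%:R / (m_ J)%:R.
Proof.
move=> J2 bx xL xS lL lS Sm phi Kphi.
have xb k : dual_ball (x k) by apply: average_dual_ball (xL k).
have l_mono : {homo l : i j / (i <= j)%N}.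
  by apply: homo_leq => //; exact: leq_trans.
have m0 i : 0 < (m_ i)%:R :> R by rewrite ltr0n ltnW // m_gt1.
have high i psi : (J <= i)%N -> decomposable i psi -> exists k0 : nat,
      forall k : 'I_(n_ J), k <> k0 :> nat -> `|act psi (x k)| <= 2 / (m_ J)%:R.
  move=> Ji dpsi.
  have bnd (k : 'I_(n_ J)) : ~~ (l k <= i < l k.+1)%N ->
      `|act psi (x k)| <= 2 / (m_ J)%:R.
    have [ilk _|lki /=] := ltnP i (l k).
      apply: le_trans (average_decomposable (xL k) dpsi (lL _ _ ilk)) _.
      by rewrite ler_wpM2l // lef_pV2 ?posrE // ler_nat leq_m.
    rewrite -leqNgt => lki'.
    apply: le_trans (decomposable_small_supp (xb k) dpsi) _.
    rewrite ler_pdivrMr // mulrAC ler_pdivlMr // -!natrM ler_nat.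
    apply: (@leq_trans (m_ i)); last by rewrite leq_pmull.
    apply: leq_trans (leq_m lki'); apply: leq_trans (Sm k).
    by rewrite leq_mul2r xS orbT.
  have [[k0 k0P]|nk0] := pselect (exists k0 : nat, l k0 <= i < l k0.+1)%N.
    exists k0 => k kk0; apply: bnd; apply/negP => kP; apply: kk0.
    have [lt|lt|//] := ltngtP (k : nat) k0.
      by have := l_mono _ _ lt; lia.
    by have := l_mono _ _ lt; lia.
  exists 0%N => k _; apply: bnd; apply/negP => kP.
  by apply: nk0; exists k.
pose r := (4 ^ J.-1)%N.
have rE : (2 ^ r)%N = m_ J by rewrite mE.
have := ris_bound J2 bx xb high (r := r) _ Kphi [set: 'I_(n_ J)]%SET.
rewrite rE leqnn => /(_ isT).
rewrite (eq_bigl xpredT) => [|k]; last by rewrite inE.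
rewrite -act_sumr cardsT card_ord => h; apply: le_trans h _.
have -> : 3 * (n_ J)%:R / (m_ J)%:R =
    2 * (n_ J)%:R / (m_ J)%:R + (n_ J)%:R / (m_ J)%:R :> R by ring.
(* With q = 4 [n_ J.-1] one has [n_ J] = q^(3r) and [m_ J] = 2^r, so q^r is at most [n_ J] /
   [m_ J]. *)
rewrite lerD2l ler_pdivlMr // -natrM ler_nat -{1}rE.
case: J J2 @r {rE x L S l bx xL xS lL lS Sm xb l_mono high} => [//|[//|J]] _ /=.
rewrite nSS expnM -expnMn leq_exp2r ?expn_gt0 //.
have := n_gt0 J.+1; set q := (4 * _)%N => n0.
have q2 : (2 <= q)%N by rewrite /q; lia.
rewrite expnS leq_mul2l; apply/orP; right; apply: leq_trans q2 _.
by apply: leq_pmulr; lia.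
Qed.

End Weighted.

Lemma leq_id_n i : (i <= n_ i)%N.
Proof.
case: i => [//|i]; elim: i => [//|i IH].
apply: leq_ltn_trans IH _; rewrite nSS; have := n_gt0 i.+1.
set n := n_ i.+1 => n0.
apply: (@leq_trans (4 * n)%N); first lia.
by rewrite -{1}[(4 * n)%N]expn1 leq_pexp2l // ?muln_gt0 ?expn_gt0 ?n0.
Qed.

(** * The norm of the completion *)

Section Space.
Context {R : realType} {d : Order.disp_t} {W : orderType d} (hW : is_omega1 W).
Context (rho : W -> W -> nat) (hrho : rho_function rho).
Context (sigma : triples nat R -> nat).
Context (X : completeNormedModType R) (iota : {linear c00 W R -> X}).
Hypothesis hX : is_completion rho sigma iota.
Local Notation K := (@norming d W R rho sigma).
Local Notation dual_ball := (@dual_ball R d W rho sigma).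
Local Notation is_average := (@is_average R d W rho sigma).
Implicit Types (phi x z : c00 W R) (Y : set X) (e : R).

Lemma omega1_inhabited : exists a : W, True.
Proof. by have [a _] := omega1_bounded hW (@countable0 W); exists a. Qed.

Lemma act_le_norm phi x : K phi -> act phi x <= `|iota x|.
Proof.
move=> Kphi; rewrite (completion_norm hX); apply: ub_le_sup; last by exists phi.
exists (\sum_(a <- msupp x) `|mcoeff a x|) => _ [psi Kpsi <-].
by apply: le_trans (ler_norm _) _; apply: act_ub; exact: norming_mcoeff Kpsi.
Qed.

Lemma norm_act_le phi x : K phi -> `|act phi x| <= `|iota x|.
Proof.
move=> Kphi; rewrite ler_norml act_le_norm // andbT lerNl -actNl.
by apply: act_le_norm; exact: norming_opp.
Qed.

Lemma norm_le x c : (forall phi, K phi -> act phi x <= c) -> `|iota x| <= c.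
Proof.
move=> h; rewrite (completion_norm hX); apply: ge_sup.
  have [a _] := omega1_inhabited.
  by exists (act (basis_vec R a) x), (basis_vec R a) => //; exact: norming_basis.
by move=> _ [phi Kphi <-]; exact: h.
Qed.

Lemma norm_gt x c : c < `|iota x| -> exists2 phi, K phi & c < act phi x.
Proof.
move=> cx; apply: contrapT => nphi; have : `|iota x| <= c.
  apply: norm_le => phi Kphi; rewrite leNgt; apply/negP => lt.
  by apply: nphi; exists phi.
by rewrite leNgt cx.
Qed.

Lemma norm_scale c x : 0 <= c -> `|iota (c *: x)| = c * `|iota x|.
Proof. by move=> c0; rewrite linearZ normrZ ger0_norm. Qed.

Lemma norm_mkmalgU a c : `|iota (mkmalgU a c)| <= `|c|.
Proof.
apply: norm_le => phi Kphi; have -> : mkmalgU a c = c *: basis_vec R a.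
  by apply/malgP => b; rewrite mcoeffZ mcoeff_basis mcoeffU mulr_natr.
rewrite actZr act_basisr; apply: le_trans (ler_norm _) _.
by rewrite normrM -[leRHS]mulr1 ler_wpM2l // (norming_mcoeff Kphi).
Qed.

Lemma norm_dual_ball x : `|iota x| <= 1 -> dual_ball x.
Proof. by move=> x1 phi Kphi; apply: le_trans (norm_act_le _ _) x1. Qed.

Lemma rat_approx (c e : R) : 0 < e -> exists q : rat, `|c - ratr q| <= e.
Proof.
move=> e0; have [q] := @rat_in_itvoo R (c - e) (c + e) ltac:(lra).
rewrite in_itv /= => /andP[q1 q2]; exists q; rewrite ler_norml; lra.
Qed.

(** The codes form a countable type, so countably many basis vectors yield countably many such
    combinations. *)
Definition rat_comb (g : nat -> W) (s : seq (nat * rat)) : c00 W R :=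
  \sum_(t <- s) mkmalgU (g t.1) (ratr t.2).

Lemma rat_comb_dense (g : nat -> W) x e : 0 < e ->
  (forall a, a \in msupp x -> range g a) ->
  exists s, `|iota x - iota (rat_comb g s)| <= e.
Proof.
move=> e0 gx.
suff main (r : seq W) : (forall a, a \in r -> range g a) -> forall e, 0 < e ->
    exists s, `|iota (\sum_(a <- r) mkmalgU a (mcoeff a x)) -
      iota (rat_comb g s)| <= e.
  by have [s sP] := main (msupp x) gx e e0; exists s; rewrite (monalgE x).
elim: r => [|a r IH] gr {e0}e e0.
  by exists [::]; rewrite /rat_comb !big_nil subrr normr0 ltW.
have e20 : 0 < e / 2 by rewrite divr_gt0.
have [s sP] := IH (fun b br => gr b (mem_behead (s := a :: r) br)) _ e20.
have [i _ ia] := gr a (mem_head _ _).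
have [q qP] := rat_approx (mcoeff a x) e20.
exists ((i, q) :: s); rewrite big_cons /rat_comb big_cons /= ia -/(rat_comb g s).
rewrite -linearB opprD addrACA -monalgUB linearD [X in _ + X]linearB.
apply: le_trans (ler_normD _ _) _; rewrite [leRHS]splitr lerD //.
exact: le_trans (norm_mkmalgU _ _) qP.
Qed.

(** Blocks live in the finitely supported vectors while [Y] lies in the completion, so they can only
    approximate its members. *)
Definition near Y e z := exists2 y, Y y & `|iota z - y| <= e.

(** * Block vectors close to a non-separable subspace *)

Section Subspace.
Context (Y : set X) (hY : nonseparable_subspace Y).

Lemma subspace0 : Y 0.
Proof. by have [[/set_mem]] := hY. Qed.

Lemma subspaceDZ c y y' : Y y -> Y y' -> Y (c *: y + y').
Proof.
by move=> Yy Yy'; have [[_ h] _] := hY; apply/set_mem/h; apply/mem_set.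
Qed.

Lemma subspaceZ c y : Y y -> Y (c *: y).
Proof.
by move=> Yy; rewrite -[_ *: _]addr0; apply: subspaceDZ => //; exact: subspace0.
Qed.

Lemma subspaceD y y' : Y y -> Y y' -> Y (y + y').
Proof. by move=> Yy Yy'; rewrite -[y]scale1r; apply: subspaceDZ. Qed.

Lemma subspaceB y y' : Y y -> Y y' -> Y (y - y').
Proof. by move=> Yy Yy'; rewrite addrC -scaleN1r; apply: subspaceDZ. Qed.

Lemma nearZ c e z : near Y e z -> near Y (`|c| * e) (c *: z).
Proof.
move=> [y Yy zy]; exists (c *: y); first exact: subspaceZ.
by rewrite linearZ -scalerBr normrZ ler_wpM2l.
Qed.

Lemma near_sum n e (z : 'I_n -> c00 W R) :
  (forall k, near Y e (z k)) -> near Y (n%:R * e) (\sum_k z k).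
Proof.
elim: n z => [|n IH] z zY.
  by exists 0; [exact: subspace0|rewrite big_ord0 linear0 subrr normr0 mul0r].
have [y Yy zy] := IH _ (fun k => zY (widen_ord (leqnSn n) k)).
have [y' Yy' zy'] := zY ord_max.
exists (y + y'); first exact: subspaceD.
rewrite big_ord_recr linearD /= opprD addrACA.
apply: le_trans (ler_normD _ _) _.
by rewrite -natr1 mulrDl mul1r lerD.
Qed.

Lemma near_le e e' z : e <= e' -> near Y e z -> near Y e' z.
Proof. by move=> ee' [y Yy zy]; exists y => //; exact: le_trans ee'. Qed.

Lemma completion_approx y e : 0 < e -> exists w, `|iota w - y| <= e.
Proof.
move=> e0; have := completion_dense hX (O := ball y e).
case=> [||x [yx [w _ wx]]]; [by exists y; exact: ballxx|exact: ball_open|].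
exists w; rewrite wx distrC; move: yx; rewrite -ball_normE; exact: ltW.
Qed.

(* Were there no such vector, a vector of Y would be determined up to a small
   error by its restriction to [-oo, b], and Y would be separable. *)
Lemma tail_vector b e : 0 < e -> exists z, above b (msupp z) /\
  exists2 y, Y y & `|iota z - y| < e * `|iota z|.
Proof.
move=> e0; apply: contrapT => nz.
have tail z y : above b (msupp z) -> Y y -> e * `|iota z| <= `|iota z - y|.
  move=> bz Yy; rewrite leNgt; apply/negP => lt.
  by apply: nz; exists z; split => //; exists y.
case: hY => _; apply.
have [g gP] : exists g : nat -> W, forall a, (a <= b)%O -> range g a.
  have cb : countable [set a | (a <= b)%O].
    have := countable_setU (omega1_initial hW b) (countable1 b).
    apply: sub_countable; apply: subset_card_le => a /=.
    by rewrite le_eqVlt => /orP[/eqP ->|ab]; [right|left].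
  have /countable_injP[f f_inj] := cb.
  have /choice[g gP] : forall n, exists a,
      (exists2 a', (a' <= b)%O & f a' = n) ->
      (a <= b)%O /\ f a = n.
    move=> n.
    have [[a ab fa]|na] := pselect (exists2 a', (a' <= b)%O & f a' = n).
      by exists a.
    by exists b.
  exists g => a ab; exists (f a) => //.
  have [|gb fg] := gP (f a); first by exists a.
  by apply: f_inj => //; rewrite inE.
pose head (w : c00 W R) : c00 W R := restrict `]-oo, b] w.
(* A code is a precision and a rational combination approximating the head; choosing one vector of
   [Y] for each realized code gives a countable set. *)
pose good (p : nat * seq (nat * rat)) y := Y y /\ exists2 w,
  `|iota w - y| <= p.1.+1%:R^-1 &
  `|iota (head w) - iota (rat_comb g p.2)| <= p.1.+1%:R^-1.
have /choice[pick pickP] : forall p, exists y,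
    (exists y', good p y') -> good p y.
  move=> p; have [[y gy]|ny] := pselect (exists y', good p y').
    by exists y.
  by exists 0 => -[y gy]; case: ny; exists y.
exists (Y `&` range pick); split.
- by apply: sub_countable (countable_range pick); apply: subset_card_le => ? [].
- by move=> ? [].
move=> y Yy B /nbhs_ballP[r /= r0 rB].
(* At accuracy h = 1 / (N+1) the distance obtained below is at most (4 / e + 4) h. *)
have [N NP] : exists N, (4 / e + 4) / N.+1%:R < r.
  exists (Num.truncn ((4 / e + 4) / r)); rewrite ltr_pdivrMr // [ltRHS]mulrC.
  by rewrite -ltr_pdivrMr // truncnS_gt.
pose h : R := N.+1%:R^-1; have h0 : 0 < h by rewrite invr_gt0.
have [w wy] := completion_approx y h0.
have [s sP] : exists s, `|iota (head w) - iota (rat_comb g s)| <= h.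
  apply: rat_comb_dense => // a; rewrite -mcoeff_neq0 mcoeff_restrict.
  by case: ifP; [rewrite in_itv /= => ab _; exact: gP|rewrite eqxx].
have [Yy' [w' wy' sP']] : good (N, s) (pick (N, s)).
  by apply: pickP; exists y; split => //; exists w.
set y' := pick _ in Yy' wy'; rewrite -/h in wy' sP'.
exists y'; split; first by split => //; exists (N, s).
apply: rB; rewrite -ball_normE /=.
(* The heads of [w] and [w'] differ by at most 2 h, so [v] is within 4 h of [y' - y], and [tail]
   bounds its norm by 4 h / e. *)
pose v := restrict `]b, +oo[ (w' - w).
have bv : above b (msupp v).
  move=> a; rewrite -mcoeff_neq0 mcoeff_restrict in_itv /= andbT.
  by case: ifP => //; rewrite eqxx.
have wv : w' - w = (head w' - head w) + v.
  apply/malgP => a; rewrite [RHS]mcoeffD !mcoeffB /v /head !mcoeff_restrict.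
  by rewrite !in_itv /= andbT mcoeffB; case: leP => _; ring.
have hu : `|iota (head w' - head w)| <= 2 * h.
  rewrite linearB; set c := iota (rat_comb g s) in sP sP'.
  rewrite -(subrK c (iota (head w'))) -addrA; apply: le_trans (ler_normD _ _) _.
  by rewrite mulr2n mulrDl !mul1r lerD // distrC.
have vy : `|iota v - (y' - y)| <= 4 * h.
  have -> : iota v - (y' - y) =
      (iota w' - y') - (iota w - y) - iota (head w' - head w).
    have -> : iota v = iota w' - iota w - iota (head w' - head w).
      have E : iota w' - iota w = iota (head w' - head w) + iota v.
        by rewrite -[LHS]linearB wv linearD.
      by rewrite E addrAC subrr add0r.
    rewrite !opprB addrAC; congr (_ - _).
    by rewrite addrACA [RHS]addrACA [- iota w + _]addrC.
  apply: le_trans (ler_normB _ _) _; have -> : 4 * h = h + h + 2 * h by ring.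
  rewrite lerD //; apply: le_trans (ler_normB _ _) _; exact: lerD.
have := le_trans (tail v (y' - y) bv (subspaceB Yy' Yy)) vy => ev.
have {}ev : `|iota v| <= 4 / e * h by rewrite mulrAC ler_pdivlMr // mulrC.
rewrite distrC; apply: le_lt_trans NP.
have -> : y' - y = iota v - (iota v - (y' - y)) by rewrite subKr.
apply: le_trans (ler_normB _ _) _; rewrite mulrDl; exact: lerD.
Qed.

(** Cutting a norming functional to the points after [b] does not change its value at [z]. *)
Lemma norming_pair b z : above b (msupp z) -> 1 / 2 < `|iota z| ->
  exists f, [/\ K f, 1 / 2 <= act f z & above b (psupp (z, f))].
Proof.
move=> bz /norm_gt[f Kf fz]; exists (restrict `]b, +oo[ f); split.
- exact: norming_restrict.
- rewrite act_restrict (_ : restrict _ z = z) ?ltW //; apply/malgP => a.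
  rewrite mcoeff_restrict in_itv /= andbT; case: ifPn => // ba.
  by rewrite mcoeff_outdom //; apply: contra ba => /bz.
- move=> a; rewrite /psupp inE => /orP[/bz//|].
  rewrite -mcoeff_neq0 mcoeff_restrict in_itv /= andbT.
  by case: ifP => //; rewrite eqxx.
Qed.

(** The error in [tail_vector] is relative to the norm, so normalizing makes it absolute. *)
Lemma normalized_supply e : 0 < e -> supply (@psupp R d W)
  (fun t => [/\ K t.2, 1 / 2 <= act t.2 t.1, `|iota t.1| <= 1 & near Y e t.1]).
Proof.
move=> e0 b; have [z [bz [y Yy zy]]] := tail_vector b e0.
have z0 : 0 < `|iota z|.
  have := le_lt_trans (normr_ge0 _) zy.
  by rewrite pmulr_rgt0.
pose c := `|iota z|^-1; have c0 : 0 < c by rewrite invr_gt0.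
have n1 : `|iota (c *: z)| = 1.
  by rewrite linearZ normrZ gtr0_norm // mulVf // gt_eqF.
have bcz : above b (msupp (c *: z)).
  by move=> a /(fsubsetP (msuppZ_le _ _)) /bz.
have [|f [Kf fz bf]] := norming_pair bcz; first by rewrite n1; lra.
exists (c *: z, f); split => //; split => //; first by rewrite n1.
have : near Y (`|c| * (e * `|iota z|)) (c *: z).
  by apply: nearZ; exists y => //; exact: ltW.
by rewrite gtr0_norm // mulrC -mulrA mulfV ?mulr1 // gt_eqF.
Qed.


Lemma msupp_scaled_sum n c (z : 'I_n -> c00 W R) a :
  a \in msupp (c *: \sum_k z k) -> exists k, a \in msupp (z k).
Proof.
move=> /(fsubsetP (msuppZ_le _ _)) ha; apply: contrapT => nk.
move: ha; rewrite -mcoeff_neq0 raddf_sum big1 ?eqxx //= => k _.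
by apply: mcoeff_outdom; apply/negP => ak; apply: nk; exists k.
Qed.

(* If averaging L consecutive blocks always halved the norm, the average of
   L^s normalized blocks would have norm at most 2^-s; but a functional of weight
   m_(2j) gives it norm at least 1 / (2 m_(2j)). *)
Lemma average_supply L e : (0 < L)%N -> 0 < e -> supply (@psupp R d W)
  (fun t => [/\ K t.2, 1 / 2 <= act t.2 t.1, is_average L t.1 & near Y e t.1]).
Proof.
move=> L0 e0 b; apply: contrapT => nt.
have small z : above b (msupp z) -> is_average L z -> near Y e z ->
    `|iota z| <= 1 / 2.
  move=> bz zL ze; rewrite leNgt; apply/negP => /(norming_pair bz)[f [Kf fz bf]].
  by apply: nt; exists (z, f).
(* With s = r + 2, 2^s is 4 [m_ (2 * j)]. This [j] is large enough for L^s blocks to be admissible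
   for the weight [m_ (2 * j)]. *)
pose j := L.+1; pose r := (4 ^ (2 * j).-1)%N; pose s := r.+2.
pose D := (L ^ s)%N.
have rE : (2 ^ r)%N = m_ (2 * j) by rewrite mE.
have D0 : (0 < D)%N by rewrite expn_gt0 L0.
have Dn : (D <= n_ (2 * j))%N.
  have -> : (2 * j = (2 * L).+2)%N by rewrite /j; lia.
  rewrite nSS; apply: (@leq_trans ((4 * n_ (2 * L).+1) ^ s)%N).
    by rewrite leq_exp2r //; have := leq_id_n (2 * L).+1; lia.
  apply: leq_pexp2l; first by rewrite muln_gt0 n_gt0.
  have -> : (4 ^ (2 * L).+1)%N = r by rewrite /r /j; congr (_ ^ _)%N; lia.
  have : (1 <= r)%N by rewrite expn_gt0.
  by rewrite /s; lia.
(* Averages are rescaled below by 2^l with l < s, which multiplies the errors. *)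
pose e' := e / (2 ^ s)%:R; have e'0 : 0 < e'.
  by rewrite divr_gt0 // ltr0n expn_gt0.
have [S sS] := supply_card_bounded hW (normalized_supply e'0).
have [t [tP tlt [phi wphi phiE]]] :=
  weighted_selection hW hrho (S := fun=> S) (j := j) (n := D) (fun=> sS)
  (fun k t h => conj (let: conj (And4 Kf _ _ _) _ := h in Kf)
     (let: conj _ c := h in c)) (isT : (0 < j)%N) (introT andP (conj D0 Dn)) b.
pose y k := (t k).1.
have {}tP k : (k < D)%N -> [/\ above b (msupp (y k)),
    1 / 2 <= act (t k).2 (y k), `|iota (y k)| <= 1 & near Y e' (y k)].
  move=> /tP[[[_ ? ? ?] _] bt]; split => // a ay; apply: bt.
  by rewrite inE ay.
pose A l o := (L ^ l)%:R^-1 *: \sum_(i < L ^ l) y (o + i)%N.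
have AS l o : A l.+1 o = L%:R^-1 *: \sum_(k < L) A l (o + k * L ^ l)%N.
  rewrite /A -scaler_sumr scalerA -invfM -natrM -expnS; congr (_ *: _).
  rewrite expnS -(big_mkord xpredT (fun i => y (o + i)%N)) big_nat_mul big_mkord.
  apply: eq_bigr => k _; rewrite -{1}[(k * L ^ l)%N]add0n big_addn.
  rewrite mulSn addnK big_mkord; apply: eq_bigr => i _.
  by rewrite -addnA [(i + _)%N]addnC.
have Asupp l o a : a \in msupp (A l o) ->
    exists2 i, (o <= i < o + L ^ l)%N & a \in msupp (y i).
  move=> /msupp_scaled_sum[i ai]; exists (o + i)%N => //.
  by rewrite leq_addr ltn_add2l /=.
have Anorm l : (l <= s)%N -> forall o, (o + L ^ l <= D)%N ->
    `|iota (A l o)| <= (2 ^ l)%:R^-1.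
  elim: l => [_ o oD|l IH ls o oD].
    rewrite /A expn0 invr1 scale1r big_ord_recl big_ord0 addr0 addn0.
    by have [|] := tP o; first lia.
  have p0 : 0 < (2 ^ l)%:R :> R by rewrite ltr0n expn_gt0.
  have kD (k : 'I_L) : (o + k * L ^ l + L ^ l <= D)%N.
    apply: leq_trans oD; rewrite -addnA leq_add2l addnC -mulSn expnS.
    by rewrite leq_mul2r ltn_ord orbT.
  (* By induction the vectors 2^l [A l] lie in the unit ball, so 2^l [A l.+1] is an average of
     length [L] and its norm is at most 1/2. *)
  have := small ((2 ^ l)%:R *: A l.+1 o).
  rewrite norm_scale // => h.
  rewrite expnS natrM invfM ler_pdivlMr // mulrC -[2^-1]div1r; apply: h.
  - move=> a /(fsubsetP (msuppZ_le _ _)) /Asupp[i io ai].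
    by have [|bi _ _ _] := tP i; [lia|exact: bi].
  - exists (fun k => (2 ^ l)%:R *: A l (o + k * L ^ l)%N); split.
    + move=> k k' kk'; apply/allrelP => a a'.
      move=> /(fsubsetP (msuppZ_le _ _)) /Asupp[i io ai].
      move=> /(fsubsetP (msuppZ_le _ _)) /Asupp[i' io' ai'].
      have ii' : (i < i' < D)%N.
        have := kD k'; have : (k * L ^ l + L ^ l <= k' * L ^ l)%N.
          by rewrite addnC -mulSn leq_mul2r kk' orbT.
        by lia.
      by have /allrelP := tlt _ _ ii'; apply.
    + move=> k; apply: norm_dual_ball; rewrite norm_scale //.
      by rewrite -ler_pdivlMl // mulr1; apply: IH => //; exact: ltnW.
    + rewrite AS scalerA mulrC -scalerA; congr (_ *: _); exact: scaler_sumr.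
  - rewrite /A scalerA.
    have ys : near Y ((L ^ l.+1)%:R * e') (\sum_(i < L ^ l.+1) y (o + i)%N).
      apply: near_sum => i.
      by have [|_ _ _] := tP (o + i)%N; first by have := ltn_ord i; lia.
    apply: near_le (nearZ ((2 ^ l)%:R / (L ^ l.+1)%:R) ys).
    have L1 : 0 < (L ^ l.+1)%:R :> R by rewrite ltr0n expn_gt0 L0.
    rewrite ger0_norm ?divr_ge0 // mulrA divfK ?gt_eqF // /e' mulrC -mulrA.
    rewrite -[leRHS]mulr1 ler_pM2l // mulrC ler_pdivrMr ?ltr0n ?expn_gt0 //.
    by rewrite mul1r ler_nat leq_exp2l // ltnW.
(* The sum of all [D] vectors would have norm at most D / (4 * 2^r), while [phi] takes a value of at
   least D / (2 * 2^r) on it. *)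
have := Anorm s (leqnn s) 0%N (leqnn _); rewrite /A norm_scale ?invr_ge0 // -/D.
rewrite ler_pdivrMl ?ltr0n //; apply/negP; rewrite -ltNge.
apply: lt_le_trans (act_le_norm _ (norming_weight wphi)).
rewrite phiE -rE.
apply: (@lt_le_trans _ _ ((2 ^ r)%:R^-1 * (D%:R * (1 / 2)))); last first.
  rewrite ler_wpM2l //; have -> : D%:R * (1 / 2) = \sum_(k < D) 1 / 2 :> R.
    by rewrite sumr_const card_ord mulr_natl.
  by apply: ler_sum => k _; have [] := tP k.
rewrite mulrCA ltr_pM2l ?ltr0n // /s 2!expnS !natrM !invfM.
have : 0 < (2 ^ r)%:R^-1 :> R by rewrite invr_gt0 ltr0n expn_gt0.
lra.
Qed.

(** The lengths and support bounds of the averages are fixed in turn before any vector is chosen.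
    The functional gains at least 1/2 on each average, and [ris_average_bound] gives the upper
    estimate. *)
Lemma ris_vector j e : (0 < j)%N -> 0 < e ->
  exists x phi, [/\ has_weight rho sigma (m_ (2 * j)) phi,
    (n_ (2 * j))%:R / (m_ (2 * j))%:R <= 2 * act phi x,
    `|iota x| <= 3 * (n_ (2 * j))%:R / (m_ (2 * j))%:R &
    near Y ((n_ (2 * j))%:R * e) x].
Proof.
move=> j0 e0; set J := (2 * j)%N.
(* This dominates [n_ i * m_ i] for all i < l, as [average_decomposable] needs. *)
pose L l := (\sum_(i < l) n_ i * m_ i).+1.
pose good l (t : c00 W R * c00 W R) := [/\ K t.2, 1 / 2 <= act t.2 t.1,
  is_average (L l) t.1 & near Y e t.1].
have /choice[S SP] : forall l, exists S, supply (@psupp R d W)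
    (fun t => good l t /\ (#|` psupp t| <= S)%N).
  by move=> l; exact: (supply_card_bounded hW (average_supply (ltn0Sn _) e0)).
(* Since [m_ i.+1] exceeds i, the next index makes its weight at least [S (l k) * m_ J]. *)
pose l k := iter k (fun l => (l + S l * m_ J).+1) 0%N.
have [b0 _] := omega1_inhabited.
have lS k : l k.+1 = (l k + S (l k) * m_ J).+1 by [].
have [t [tP tlt [phi wphi phiE]]] :=
  weighted_selection hW hrho (S := fun k => S (l k)) (j := j) (n := n_ J)
  (fun k => SP (l k))
  (fun k t h => conj (let: conj (And4 Kf _ _ _) _ := h in Kf)
     (let: conj _ c := h in c)) j0 (introT andP (conj (n_gt0 J) (leqnn _)))
  b0.
exists (\sum_(k < n_ J) (t k).1), phi; split => //.
- rewrite phiE mulrCA [leLHS]mulrC ler_wpM2l // mulr_sumr.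
  have -> : (n_ J)%:R = \sum_(k < n_ J) 1 :> R by rewrite sumr_const card_ord.
  apply: ler_sum => k _; have [[[_ h _ _] _] _] := tP k (ltn_ord k); lra.
- apply: norm_le => psi Kpsi; apply: le_trans (ler_norm _) _.
  apply: (ris_average_bound (L := fun k => L (l k)) (S := fun k => S (l k))
    (l := l)) Kpsi => //.
  + by rewrite /J; lia.
  + by move=> i k ik; apply: tlt; rewrite ik ltn_ord.
  + by move=> k; have [[[]]] := tP k (ltn_ord k).
  + move=> k; have [[_ c] _] := tP k (ltn_ord k).
    by apply: leq_trans c; apply: fsubset_leq_card; exact: fsubsetUl.
  + move=> k i il; rewrite /L ltnW // ltnS.
    by rewrite (bigD1 (Ordinal il)) //= leq_addr.
  + by move=> k; rewrite lS; lia.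
  + by move=> k; rewrite lS; apply: leq_trans (ltnW (ltn_m _)); lia.
- apply: near_sum => k; by have [[[]]] := tP k (ltn_ord k).
Qed.

End Subspace.
End Space.

(** * Extension of a norm to the completion *)

Lemma seminorm_extension (R : realType) (V : lmodType R) (X : normedModType R)
    (iota : {linear V -> X}) (A : V -> R) (c C : R) : 0 < c -> c <= C ->
    (forall u v, A (u + v) <= A u + A v) ->
    (forall a v, A (a *: v) <= `|a| * A v) ->
    (forall v, c * `|iota v| <= A v /\ A v <= C * `|iota v|) ->
  exists N : X -> R, [/\ equivalent_norm N, forall v, N (iota v) = A v &
    forall x, c * `|x| <= N x /\ N x <= C * `|x|].
Proof.
move=> c0 cC AD AZ Abnd; have C0 : 0 < C by exact: lt_le_trans cC.
have A0 : A 0 <= 0 by have := AZ 0 0; rewrite scaler0 normr0 mul0r.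
(* The extension is the infimal convolution of [A] with [C] times the norm; subadditivity and the
   upper bound on [A] make it agree with [A] on the image of [iota]. *)
pose E x := [set A v + C * `|x - iota v| | v in [set: V]].
pose N x := inf (E x).
have lb x v : c * `|x| <= A v + C * `|x - iota v|.
  have [h _] := Abnd v.
  apply: (@le_trans _ _ (c * `|iota v| + c * `|x - iota v|)).
    rewrite -mulrDr ler_pM2l //; apply: le_trans (ler_normD _ _).
    by rewrite addrC subrK.
  by apply: lerD => //; rewrite ler_wpM2r.
have E0 x : E x !=set0 by exists (A 0 + C * `|x - iota 0|), 0.
have Nle x v : N x <= A v + C * `|x - iota v|.
  by apply: ge_inf; [exists (c * `|x|) => _ [w _ <-]; exact: lb|exists v].
have leN x b : (forall v, b <= A v + C * `|x - iota v|) -> b <= N x.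
  by move=> h; apply: lb_le_inf => // _ [v _ <-]; exact: h.
have Ncx x : c * `|x| <= N x by apply: leN => v; exact: lb.
have NCx x : N x <= C * `|x|.
  apply: le_trans (Nle x 0) _; rewrite linear0 subr0.
  by rewrite -[leRHS]add0r lerD2r.
have N0 : N 0 = 0.
  apply/le_anti; have := Ncx 0; have := NCx 0.
  by rewrite !normr0 !mulr0 => -> ->.
have NZ_le a x : N (a *: x) <= `|a| * N x.
  have [->|a0] := eqVneq a 0; first by rewrite scale0r N0 normr0 mul0r.
  have na : 0 < `|a| by rewrite normr_gt0.
  rewrite mulrC -ler_pdivrMr //; apply: leN => v.
  rewrite ler_pdivrMr //; apply: le_trans (Nle _ (a *: v)) _.
  rewrite mulrDl; apply: lerD; first by rewrite mulrC.
  by rewrite linearZ -scalerBr normrZ mulrCA mulrC.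
exists N; split => //.
- split.
  + move=> x y; rewrite -lerBlDl; apply: (leN) => w.
    rewrite lerBlDl -lerBlDr; apply: leN => v.
    rewrite lerBlDr; apply: le_trans (Nle _ (v + w)) _.
    rewrite addrACA; apply: lerD => //.
    by rewrite -mulrDr ler_pM2l // linearD opprD addrACA ler_normD.
  + move=> a x; apply/le_anti; rewrite NZ_le /=.
    have [->|a0] := eqVneq a 0; first by rewrite scale0r N0 normr0 mul0r.
    have na : 0 < `|a| by rewrite normr_gt0.
    (* The reverse inequality is homogeneity for the inverse scalar. *)
    have := NZ_le a^-1 (a *: x); rewrite scalerA mulVf // scale1r normfV.
    by rewrite mulrC ler_pdivlMr // mulrC.
  + move=> x Nx; have := Ncx x; rewrite Nx pmulr_rle0 // => x0.
    by apply/eqP; rewrite -normr_le0.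
  + by exists c, C.
- move=> v; apply/le_anti/andP; split.
    by apply: le_trans (Nle _ v) _; rewrite subrr normr0 mulr0 addr0.
  apply: leN => w; rewrite -linearB -{1}(subrK w v) addrC.
  by apply: le_trans (AD _ _) _; rewrite lerD2l; have [] := Abnd (v - w).
Qed.

(** * The distorting norms *)

Section Distortion.
Context {R : realType} {d : Order.disp_t} {W : orderType d} (hW : is_omega1 W).
Context (rho : W -> W -> nat) (hrho : rho_function rho).
Context (sigma : triples nat R -> nat).
Context (X : completeNormedModType R) (iota : {linear c00 W R -> X}).
Hypothesis hX : is_completion rho sigma iota.
Local Notation K := (@norming d W R rho sigma).
Implicit Types (phi x z : c00 W R).

Definition weight_norm w x : R :=
  sup [set `|act phi x| | phi in has_weight rho sigma w].

Lemma weight_norm_ge w phi x : has_weight rho sigma w phi ->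
  `|act phi x| <= weight_norm w x.
Proof.
move=> wphi; apply: ub_le_sup; last by exists phi.
exists `|iota x| => _ [psi wpsi <-].
exact: (norm_act_le hX x (norming_weight wpsi)).
Qed.

Lemma has_weight_inhabited j : (0 < j)%N ->
  exists phi, has_weight rho sigma (m_ (2 * j)) phi.
Proof.
move=> j0; have [a _] := omega1_inhabited hW.
exists (scaled_sum (m_ (2 * j)) [:: basis_vec R a]); apply: weight_even => //.
- by move=> phi; rewrite inE => /eqP ->; exact: norming_basis.
- by move=> [|i] [|k].
- exact: n_gt0.
Qed.

Lemma weight_norm_le j x c : (0 < j)%N ->
  (forall phi, has_weight rho sigma (m_ (2 * j)) phi -> `|act phi x| <= c) ->
  weight_norm (m_ (2 * j)) x <= c.
Proof.
move=> j0 h; apply: ge_sup; last by move=> _ [phi wphi <-]; exact: h.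
by have [phi wphi] := has_weight_inhabited j0; exists `|act phi x|, phi.
Qed.

(** In every [Y], a normalized sum of averages has new norm at least 1/16 and a normalized long
    average at most 20 / m; this is the origin of 320. *)
Lemma distorting_norm j : (1 < j)%N ->
  exists N : X -> R, equivalent_norm N /\
    (((m_ (2 * j))%:R / 320)%:E <= distortion_omega1 N)%E.
Proof.
move=> j1; set J := (2 * j)%N; have j0 : (0 < j)%N by exact: ltnW.
set m : R := (m_ J)%:R; set n : R := (n_ J)%:R.
have m4 : 4 <= m.
  have : (J.-1 < m_ J)%N.
    by have := ltn_m J.-1; rewrite prednK // /J muln_gt0.
  rewrite /m (ler_nat R 4) /J; lia.
have m0 : 0 < m by exact: lt_le_trans m4.
have n0 : 0 < n by rewrite ltr0n n_gt0.
pose B := weight_norm (m_ J).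
have B_le x : B x <= `|iota x|.
  apply: weight_norm_le => // phi wphi.
  exact: (norm_act_le hX x (norming_weight wphi)).
have B0 x : 0 <= B x.
  have [phi wphi] := has_weight_inhabited j0.
  exact: le_trans (normr_ge0 _) (weight_norm_ge x wphi).
(* The second term gives equivalence with the original norm, and is no larger than the order 1 / m
   of [B] on long averages. *)
pose A x := B x + m^-1 * `|iota x|.
have mV : m^-1 <= 1 by rewrite invf_le1 //; lra.
have [| | | | |N [eqN NA Nbnd]] :=
  @seminorm_extension R _ X iota A m^-1 2.
- by rewrite invr_gt0.
- by lra.
- move=> u v; rewrite /A addrACA lerD //.
    apply: weight_norm_le => // phi wphi; rewrite linearD.
    apply: le_trans (ler_normD _ _) _.
    by apply: lerD; exact: weight_norm_ge.
  by rewrite -mulrDr ler_pM2l ?invr_gt0 // linearD ler_normD.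
- move=> a v; rewrite /A mulrDr lerD //.
    apply: weight_norm_le => // phi wphi; rewrite actZr normrM ler_wpM2l //.
    exact: weight_norm_ge.
  by rewrite linearZ normrZ mulrCA.
- move=> v; split; first by rewrite /A lerDr.
  rewrite /A mulr2n mulrDl !mul1r lerD // -[leRHS]mul1r ler_wpM2r //.
exists N; split => //.
have Nlip (x y : X) : N y <= N x + 2 * `|x - y|.
  rewrite -{1}(subrK x y) addrC; apply: le_trans (enorm_triangle eqN _ _) _.
  by rewrite lerD2l distrC; have [] := Nbnd (y - x).
apply: le_ereal_inf_tmp => _ [Y hY <-].
(* The [n_ J] errors of size 1 / (8 m) add up to t / 8, small against the norm of the sum, which is
   of order t = n / m. *)
have [x [phi [wphi phix xn [y1 Yy1 xy1]]]] :=
  ris_vector hW hrho hX hY j0 (e := (8 * m)^-1) ltac:(rewrite invr_gt0; lra).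
have e0 : 0 < m^-1 by rewrite invr_gt0.
have L0 : (0 < n_ J * m_ J)%N by rewrite muln_gt0 n_gt0 ltnW // m_gt1.
have [b0 _] := omega1_inhabited hW.
have [[z f] [[/= Kf fz zav [y2 Yy2 zy2]] _]] :=
  average_supply hW hrho hX hY L0 e0 b0.
rewrite -/J -/m -/n in phix xn xy1.
pose t := n / m; have t0 : 0 < t by rewrite divr_gt0.
have xn' : `|iota x| <= 3 * t by rewrite /t mulrA.
have xy1' : `|iota x - y1| <= t / 8.
  by apply: le_trans xy1 _; rewrite /t -mulrA -invfM [m * _]mulrC.
have Nx : t / 2 <= N (iota x).
  rewrite NA /A; have := weight_norm_ge x wphi; rewrite -/J -/B.
  have := ler_norm (act phi x).
  have : 0 <= m^-1 * `|iota x| by rewrite mulr_ge0 // ltW.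
  by rewrite -/t in phix; lra.
have Ny1 : t / 4 <= N y1.
  have := Nlip y1 (iota x); rewrite distrC; lra.
have y1n : `|y1| <= 4 * t.
  have := ler_normB (iota x) (iota x - y1); rewrite subKr; lra.
have y1p : 0 < `|y1|.
  have [_] := Nbnd y1; rewrite -[2 * _]/(2 * _); lra.
have zn : 1 / 2 <= `|iota z| by apply: le_trans fz _; exact: (act_le_norm hX).
have zn1 : `|iota z| <= 1.
  apply: (norm_le hW hX) => psi Kpsi; apply: le_trans (ler_norm _) _.
  exact: average_dual_ball zav _ Kpsi.
have Bz : B z <= 2 / m.
  apply: weight_norm_le => // psi wpsi.
  have [i [i2 mi dpsi]] := has_weight_decomposable wpsi.
  have J0 : (0 < J)%N by rewrite muln_gt0.
  (* The weight determines the index, so the length [n_ J * m_ J] of the average is sufficient. *)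
  have iJ := m_inj (ltnW i2) J0 (esym mi).
  rewrite iJ in dpsi.
  exact: average_decomposable zav dpsi (leqnn _).
have Nz : N (iota z) <= 3 / m.
  rewrite NA /A; have : m^-1 * `|iota z| <= m^-1 by rewrite ler_piMr // ltW.
  lra.
have Ny2 : N y2 <= 5 / m by have := Nlip (iota z) y2; lra.
have mV4 : m^-1 <= 1 / 4 by rewrite div1r lef_pV2 ?posrE.
have y2n : 1 / 4 <= `|y2|.
  have := ler_normB (iota z) (iota z - y2); rewrite subKr.
  have := ler_normD (iota z - y2) y2; rewrite subrK; lra.
have y2p : 0 < `|y2| by lra.
pose u1 := `|y1|^-1 *: y1; pose u2 := `|y2|^-1 *: y2.
have unit (y : X) : 0 < `|y| -> `| `|y|^-1 *: y| = 1.
  by move=> y0; rewrite normrZ gtr0_norm ?invr_gt0 // mulVf // gt_eqF.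
apply: (@le_trans _ _ (N u1 / N u2)%:E); last first.
  apply: ereal_sup_ubound; exists (u1, u2) => //=.
  by split; [exact: (subspaceZ hY)|exact: (subspaceZ hY)|exact: unit..].
have Nu y : 0 < `|y| -> N (`|y|^-1 *: y) = N y / `|y|.
  by move=> y0; rewrite (enorm_scale eqN) gtr0_norm ?invr_gt0 // mulrC.
have Nu1 : 1 / 16 <= N u1.
  rewrite Nu // ler_pdivlMr //; lra.
have Nu2 : N u2 <= 20 / m.
  rewrite Nu // ler_pdivrMr //; apply: le_trans Ny2 _.
  have -> : 20 / m * `|y2| = (20 * `|y2|) / m by rewrite mulrAC.
  by rewrite ler_wpM2r ?invr_ge0 ?(ltW m0) //; lra.
have Nu2p : 0 < N u2.
  have [h _] := Nbnd u2; apply: lt_le_trans h; rewrite mulr_gt0 //.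
  by rewrite unit.
rewrite lee_fin ler_pdivlMr //; apply: le_trans Nu1.
apply: (@le_trans _ _ (m / 320 * (20 / m))).
  by rewrite ler_wpM2l // divr_ge0 // ltW.
have -> : m / 320 * (20 / m) = (m / m) * (1 / 16) by field; rewrite gt_eqF.
by rewrite mulfV ?mul1r // gt_eqF.
Qed.

End Distortion.

Theorem theorem3p4 (R : realType) (d : Order.disp_t) (W : orderType d)
    (hW : is_omega1 W)
    (rho : W -> W -> nat) (hrho : rho_function rho)
    (sigma : triples nat R -> nat) (hsigma : coding_function sigma)
    (X : completeNormedModType R) (iota : {linear c00 W R -> X})
    (hX : is_completion rho sigma iota) :
  arbitrarily_omega1_distortable X.
Proof.
apply/eqyP => M M0.
(* As [m_ i.+1] exceeds i, this makes [m_ (2 * j)] larger than 320 M. *)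
pose j := (Num.truncn (320 * M)).+2.
have [N [eqN hN]] := distorting_norm hW hrho hX (j := j) isT.
apply: le_trans (ereal_sup_ubound _); last by exists N.
apply: le_trans hN; rewrite lee_fin ler_pdivlMr // mulrC.
apply: le_trans (ltW (truncnS_gt _)) _; rewrite ler_nat.
have := ltn_m (2 * j).-1; rewrite prednK ?muln_gt0 // => h.
by apply: leq_trans h; rewrite /j; move: (Num.truncn _) => t; lia.
Qed.
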